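(* Consider the planar Stark problem $$\ddot x=-\frac{x}{r^3}+1,\qquad \ddot y=-\frac{y}{r^3},\qquad r=\sqrt{x^2+y^2}.$$ For any $a'\in(-1,1)$ there exist $k_b\in\mathbb N$ and real numbers $\{d_k\}_{k\ge k_b}$, $\{d'_k\}_{k\ge k_b}$ such that, letting $A'_k$ and $B'_k$ denote the solutions with zero initial velocity $(\dot x(0),\dot y(0))=(0,0)$ and initial positions $(x(0),y(0))=(a',d_k)$ and $(a',d'_k)$ respectively, the following hold: (i) $A'_k$ is a brake orbit which intersects the positive $x$-axis $k$ times and then intersects the negative $x$-axis perpendicularly; (ii) $B'_k$ is a collision orbit which intersects the positive $x$-axis $k$ times before collision with the origin; (iii) $\lim_{k\to+\infty}d_k=\lim_{k\to+\infty}d'_k=\sqrt{1-a'^2}$, and $\lim_{a'\to1}k_b=+\infty$, where $k_b=k_b(a')$ is taken as small as possible; (iv) $d_k<d'_k$ and $d'_k<d_{k+1}$ for all $k\ge k_b$.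
   Context: A brake orbit is a periodic orbit such that $\dot q=0$ at some time. A collision orbit is a solution reaching the origin in finite time. The positive (resp. negative) $x$-axis is $\{(x,0):x>0\}$ (resp. $\{(x,0):x<0\}$). *)

(* Defs.v *)
From Stdlib Require Import Reals Lra List.
From Coquelicot Require Import Coquelicot.
Open Scope R_scope.

Definition rad (x y : R) : R := sqrt (x ^ 2 + y ^ 2).

Definition stark_sol_on (D : R -> Prop) (x y : R -> R) : Prop :=
  forall t, D t ->
    0 < rad (x t) (y t) /\
    ex_derive x t /\ ex_derive y t /\
    is_derive (Derive x) t (- x t / (rad (x t) (y t)) ^ 3 + 1) /\
    is_derive (Derive y) t (- y t / (rad (x t) (y t)) ^ 3).

Definition init_rest (x y : R -> R) (x0 y0 : R) : Prop :=
  x 0 = x0 /\ y 0 = y0 /\ Derive x 0 = 0 /\ Derive y 0 = 0.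

Definition exactly_n_times (P : R -> Prop) (k : nat) : Prop :=
  exists l : list R, NoDup l /\ length l = k /\ forall t, In t l <-> P t.

(* A'_k: the solution with data (a', d) at rest is a brake orbit (a globally
   defined periodic solution; its velocity vanishes at t = 0) which, on
   (0,T), meets the positive x-axis exactly k times and never the negative
   x-axis, and at time T meets the negative x-axis perpendicularly. *)
Definition brake_orbit_k (a' d : R) (k : nat) : Prop :=
  exists x y : R -> R,
    stark_sol_on (fun _ => True) x y /\ init_rest x y a' d /\
    (exists P, 0 < P /\ forall t, x (t + P) = x t /\ y (t + P) = y t) /\
    exists T, 0 < T /\
      exactly_n_times (fun t => 0 < t < T /\ y t = 0 /\ 0 < x t) k /\
      (forall t, 0 < t < T -> y t = 0 -> 0 < x t) /\
      y T = 0 /\ x T < 0 /\ Derive x T = 0.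

Definition collision_orbit_k (a' d : R) (k : nat) : Prop :=
  exists (x y : R -> R) (a T : R), a < 0 < T /\
    stark_sol_on (fun t => a < t < T) x y /\ init_rest x y a' d /\
    filterlim x (at_left T) (locally 0) /\
    filterlim y (at_left T) (locally 0) /\
    exactly_n_times (fun t => 0 < t < T /\ y t = 0 /\ 0 < x t) k.

(* Conclusions (i)-(iv) (except the statement about k_b -> oo) for a given
   a' and starting index kb. *)
Definition stark_conclusion (a' : R) (kb : nat) : Prop :=
  exists d d' : nat -> R,
    (forall k, (kb <= k)%nat -> brake_orbit_k a' (d k) k) /\
    (forall k, (kb <= k)%nat -> collision_orbit_k a' (d' k) k) /\
    is_lim_seq d (sqrt (1 - a' ^ 2)) /\
    is_lim_seq d' (sqrt (1 - a' ^ 2)) /\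
    (forall k, (kb <= k)%nat -> d k < d' k /\ d' k < d (S k)).

(* Main.v *)
(** In parabolic coordinates [x = (u^2 - v^2)/2], [y = u v] with the time change
    [dt = (u^2 + v^2) ds] the Stark problem separates.  For an orbit released at rest
    at distance [r < 1] both coordinates oscillate, [u = u0 cos phi] and
    [v = v0 cos psi], with phases solving [phi' = sqrt (A - B cos^2 phi)].
    The positive [x]-axis is [v = 0], the negative one is [u = 0], so the orbit is a
    brake (resp. collision) orbit of index [k] as soon as the quarter period of [u] is
    [2 k] (resp. [2 k + 1]) times that of [v].  As [r] tends to [1] the coordinate [u]
    starts ever closer to a saddle, so the ratio of the quarter periods tends to
    infinity; taking for [d_k], [d'_k] the last points where this continuous ratio
    takes the values [2 k], [2 k + 1] gives existence, monotonicity and the limits.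

    When [a'] is close to [1] the initial point is either outside the unit circle,
    where the invariants keep [r + x] away from [0] and the negative axis is never
    reached, or close to the equilibrium [(1, 0)].  In that case the orbit stays there
    for a long time, during which [y'' = - y / r^3] has many zeros. *)

Require Import Defs.
From Stdlib Require Import Reals ZArith Lra Lia List FinFun Classical ClassicalEpsilon.
From Coquelicot Require Import Coquelicot.
Open Scope R_scope.

(** * Crossings and inverse functions *)

Lemma continuity_pt_eps (f : R -> R) (x eps : R) :
  continuity_pt f x -> 0 < eps ->
  exists eta, 0 < eta /\ forall y, Rabs (y - x) < eta -> Rabs (f y - f x) < eps.
Proof.
  intros Hc He.
  destruct (Hc eps He) as [eta [Heta Hf]].
  exists eta; split; [exact Heta|].
  intros y Hy. destruct (Req_dec x y) as [->|Hxy].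
  - rewrite Rminus_diag, Rabs_R0; exact He.
  - apply Hf. split; [|exact Hy]. split; [exact I|exact Hxy].
Qed.

(** The crossing time is the supremum of the times up to which [f] has stayed below [c]; continuity
    excludes both [f t < c] and [f t > c] there. *)
Lemma first_crossing (f : R -> R) (a b c : R) :
  a <= b -> (forall t, a <= t <= b -> continuity_pt f t) -> f a < c <= f b ->
  exists t, a < t <= b /\ f t = c /\ forall s, a <= s < t -> f s < c.
Proof.
  intros Hab Hc Hf.
  set (E := fun t => a <= t <= b /\ forall s, a <= s <= t -> f s < c).
  assert (Ea : E a).
  { split; [lra|]. intros s Hs. replace s with a by lra. lra. }
  destruct (completeness E) as [t [Hub Hleast]].
  { exists b. intros s [Hs _]. lra. }
  { exists a; exact Ea. }
  assert (Hat : a <= t) by (apply Hub; exact Ea).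
  assert (Htb : t <= b) by (apply Hleast; intros s [Hs _]; lra).
  assert (Hbelow : forall s, a <= s < t -> f s < c).
  { intros s Hs. destruct (Rlt_le_dec (f s) c) as [|Hge]; [assumption|exfalso].
    assert (t <= s); [|lra].
    apply Hleast. intros z [Hz Hz']. destruct (Rle_lt_dec z s); [assumption|].
    specialize (Hz' s ltac:(lra)). lra. }
  assert (Hft : f t = c).
  { destruct (Rtotal_order (f t) c) as [Hlt|[Heq|Hgt]]; [exfalso|exact Heq|exfalso].
    - destruct (continuity_pt_eps f t (c - f t) (Hc t ltac:(lra)) ltac:(lra))
        as [eta [Heta Hn]].
      assert (t <> b) by (intros ->; lra).
      assert (HE : E (Rmin b (t + eta / 2))).
      { split.
        - split; [apply Rmin_glb; lra|apply Rmin_l].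
        - intros s [Hs1 Hs2]. destruct (Rlt_le_dec s t).
          + apply Hbelow; lra.
          + assert (s <= t + eta / 2) by (eapply Rle_trans; [exact Hs2|apply Rmin_r]).
            specialize (Hn s). rewrite Rabs_pos_eq in Hn by lra.
            specialize (Hn ltac:(lra)). apply Rabs_def2 in Hn. lra. }
      apply Hub in HE. assert (t < Rmin b (t + eta / 2)); [|lra].
      apply Rmin_glb_lt; lra.
    - destruct (continuity_pt_eps f t (f t - c) (Hc t ltac:(lra)) ltac:(lra))
        as [eta [Heta Hn]].
      assert (a <> t) by (intros ->; lra).
      pose (s := Rmax a (t - eta / 2)).
      assert (Hs : a <= s < t).
      { split; [apply Rmax_l|apply Rmax_lub_lt; lra]. }
      assert (t - eta / 2 <= s) by apply Rmax_r.
      specialize (Hbelow s Hs). specialize (Hn s).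
      assert (Hd : Rabs (s - t) < eta) by (apply Rabs_def1; lra).
      specialize (Hn Hd). apply Rabs_def2 in Hn. lra. }
  exists t. repeat split; try assumption.
  destruct (Req_dec a t) as [Heq|]; [|lra]. rewrite <- Heq in Hft. lra.
Qed.

(** Time reversal: this is the first crossing of [fun t => - f (- t)] at level [- c]. *)
Lemma last_crossing (f : R -> R) (a b c : R) :
  a <= b -> (forall t, a <= t <= b -> continuity_pt f t) -> f a <= c < f b ->
  exists t, a <= t < b /\ f t = c /\ forall s, t < s <= b -> c < f s.
Proof.
  intros Hab Hc Hf.
  destruct (first_crossing (fun t => - f (- t)) (- b) (- a) (- c)) as [t [Ht [Hft Hs]]].
  - lra.
  - intros t Ht. apply continuity_pt_opp.
    apply (continuity_pt_comp (fun t => - t) f).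
    + apply continuity_pt_opp, continuity_pt_id.
    + apply Hc. lra.
  - rewrite !Ropp_involutive. lra.
  - exists (- t). split; [lra|]. split; [lra|].
    intros s Hst. specialize (Hs (- s) ltac:(lra)). rewrite Ropp_involutive in Hs. lra.
Qed.

(** [c m] is taken as the last point of level [m], which makes up for [f] not being monotone. Since
    [f] stays above [m + 1] after [c (S m)], the point [c m] comes earlier; and once [m] exceeds
    [f t1], level [m] is last attained after [t1], which forces convergence to [b]. *)
Lemma levels_of_divergent (f : R -> R) (a b : R) :
  a < b -> (forall t, a <= t < b -> continuity_pt f t) ->
  (forall N : nat, exists t0, a <= t0 < b /\ forall t, t0 <= t < b -> INR N < f t) ->
  exists (m0 : nat) (c : nat -> R),
    (forall m, (m0 <= m)%nat -> a <= c m < b /\ f (c m) = INR m /\ c m < c (S m)) /\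
    is_lim_seq c b.
Proof.
  intros Hab Hc Hinf.
  destruct (nfloor_ex (Rmax 0 (f a)) (Rmax_l _ _)) as [n0 [_ Hn0]].
  pose proof (Rmax_r 0 (f a)) as Hmax.
  (* [m0] exceeds [f a], so every level from [m0] on has to be crossed. *)
  pose (m0 := S n0).
  assert (Hm0 : f a < INR m0) by (unfold m0; rewrite S_INR; lra).
  pose (last := fun (m : nat) t => a <= t < b /\ f t = INR m /\
    forall s, t < s < b -> INR m < f s).
  pose (c := fun m : nat => epsilon (inhabits 0) (last m)).
  assert (Hlast : forall m : nat, (m0 <= m)%nat -> last m (c m)).
  { intros m Hm. unfold c. apply epsilon_spec.
    apply le_INR in Hm.
    destruct (Hinf m) as [t0 [Ht0 Hf0]].
    destruct (last_crossing f a t0 (INR m)) as [t [Ht [Hft Hs]]].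
    - lra.
    - intros t Ht. apply Hc. lra.
    - specialize (Hf0 t0 ltac:(lra)). lra.
    - exists t. split; [lra|]. split; [exact Hft|].
      intros s Hst. destruct (Rle_lt_dec s t0); [apply Hs; lra|apply Hf0; lra]. }
  exists m0, c. split.
  - intros m Hm. destruct (Hlast m Hm) as [Hcm [Hfm Hsm]].
    destruct (Hlast (S m) ltac:(lia)) as [Hcm' [Hfm' Hsm']].
    split; [exact Hcm|]. split; [exact Hfm|].
    rewrite S_INR in *.
    destruct (Rtotal_order (c m) (c (S m))) as [Hlt|[Heq|Hgt]]; [exact Hlt| |].
    + rewrite Heq in Hfm. lra.
    + specialize (Hsm' (c m) ltac:(lra)). lra.
  - apply is_lim_seq_spec. intros eps.
    pose (t1 := Rmax a (b - eps / 2)).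
    pose proof (cond_pos eps) as Heps.
    assert (Ht1 : a <= t1 < b) by (split; [apply Rmax_l|apply Rmax_lub_lt; lra]).
    assert (Ht1' : b - eps / 2 <= t1) by apply Rmax_r.
    destruct (nfloor_ex (Rmax 0 (f t1)) (Rmax_l _ _)) as [n1 [_ Hn1]].
    pose proof (Rmax_r 0 (f t1)) as Hmax1.
    exists (max m0 (S n1)). intros m Hm.
    destruct (Hlast m ltac:(lia)) as [Hcm [Hfm Hsm]].
    assert (HmR : INR (S n1) <= INR m) by (apply le_INR; lia).
    rewrite S_INR in HmR.
    assert (t1 <= c m).
    { destruct (Rle_lt_dec t1 (c m)) as [|Hlt]; [assumption|].
      specialize (Hsm t1 ltac:(lra)). lra. }
    apply Rabs_def1; lra.
Qed.

(** * Monotonicity and differentiable inverses *)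

Lemma eq_of_derive_0 (f : R -> R) (a b : R) :
  (forall t, is_derive f t 0) -> f a = f b.
Proof.
  intros Hf. destruct (Rtotal_order a b) as [H|[->|H]]; [|reflexivity|].
  - apply (eq_is_derive f a b); [intros; apply Hf|exact H].
  - symmetry. apply (eq_is_derive f b a); [intros; apply Hf|exact H].
Qed.

Lemma is_derive_continuity_pt (f : R -> R) (t l : R) :
  is_derive f t l -> continuity_pt f t.
Proof.
  intros H. apply continuity_pt_filterlim, (ex_derive_continuous f).
  exists l. exact H.
Qed.

(** An open interval, possibly the whole line. The neighbourhood is closed so that its endpoints can
    be used as points of [D]. *)
Definition open_convex (D : R -> Prop) : Prop :=
  (forall s, D s -> exists eta, 0 < eta /\ forall z, Rabs (z - s) <= eta -> D z) /\
  (forall s z t, D s -> D t -> s <= z <= t -> D z).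

Lemma open_convex_True : open_convex (fun _ => True).
Proof.
  split; [intros; exists 1; split; [lra|]; intros; exact I|intros; exact I].
Qed.

Lemma lt_of_derive_pos (H h : R -> R) (s t : R) :
  (forall z, is_derive H z (h z)) -> s < t -> (forall z, s < z < t -> 0 < h z) ->
  H s < H t.
Proof.
  intros Hd Hst Hp.
  destruct (MVT_cor2 H h s t Hst) as [z [Heq Hz]].
  - intros z _. apply is_derive_Reals, Hd.
  - specialize (Hp z Hz). nra.
Qed.

Lemma increasing_of_derive_pos (D : R -> Prop) (H h : R -> R) :
  (forall s z t, D s -> D t -> s <= z <= t -> D z) ->
  (forall s, is_derive H s (h s)) -> (forall s, D s -> 0 < h s) ->
  forall s t, D s -> D t -> s < t -> H s < H t.
Proof.
  intros HD Hd Hp s t Hs Ht Hst. apply (lt_of_derive_pos H h); [exact Hd|exact Hst|].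
  intros z Hz. apply Hp, (HD s z t); [assumption|assumption|lra].
Qed.

(* Outside the image of [D] the inverse takes arbitrary values. *)
Definition inverse_on (D : R -> Prop) (H : R -> R) (t : R) : R :=
  epsilon (inhabits 0) (fun s => D s /\ H s = t).

Section InverseFunction.
Variables (D : R -> Prop) (H h : R -> R).
Hypothesis HD : open_convex D.
Hypothesis Hd : forall s, is_derive H s (h s).
Hypothesis Hp : forall s, D s -> 0 < h s.

Lemma inverse_onK (s : R) : D s -> inverse_on D H (H s) = s.
Proof.
  intros Hs. unfold inverse_on.
  destruct (epsilon_spec (inhabits 0) (fun z => D z /\ H z = H s)) as [Dz Hz].
  { exists s; split; [exact Hs|reflexivity]. }
  set (z := epsilon _ _) in *.
  pose proof (increasing_of_derive_pos D H h (proj2 HD) Hd Hp) as Hinc.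
  destruct (Rtotal_order z s) as [Hlt|[->|Hgt]]; [|reflexivity|].
  - specialize (Hinc z s Dz Hs Hlt). lra.
  - specialize (Hinc s z Hs Dz Hgt). lra.
Qed.

(** [H] is strictly increasing on a small interval around [s] inside [D], so intermediate values
    fill a neighbourhood of [H s]. This gives at once the openness of the image and the continuity
    of the inverse. *)
Lemma image_nbhd (s eta : R) : D s -> 0 < eta ->
  exists eps, 0 < eps /\ forall t, Rabs (t - H s) < eps ->
    exists z, Rabs (z - s) < eta /\ D z /\ H z = t.
Proof.
  intros Hs Heta.
  destruct (proj1 HD s Hs) as [eta0 [Heta0 HDn]].
  pose (r := Rmin (eta / 2) eta0).
  assert (Hr : 0 < r) by (apply Rmin_glb_lt; lra).
  assert (r <= eta / 2) by apply Rmin_l.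
  assert (r <= eta0) by apply Rmin_r.
  assert (Dl : D (s - r)) by (apply HDn; rewrite Rabs_left1; lra).
  assert (Dr : D (s + r)) by (apply HDn; rewrite Rabs_pos_eq; lra).
  pose proof (increasing_of_derive_pos D H h (proj2 HD) Hd Hp) as Hinc.
  pose proof (Hinc (s - r) s Dl Hs ltac:(lra)) as Hl.
  pose proof (Hinc s (s + r) Hs Dr ltac:(lra)) as Hu.
  exists (Rmin (H s - H (s - r)) (H (s + r) - H s)).
  split; [apply Rmin_glb_lt; lra|].
  intros t Ht. apply Rabs_def2 in Ht.
  pose proof (Rmin_l (H s - H (s - r)) (H (s + r) - H s)).
  pose proof (Rmin_r (H s - H (s - r)) (H (s + r) - H s)).
  destruct (first_crossing H (s - r) (s + r) t) as [z [Hz [Hzt _]]].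
  - lra.
  - intros z _. eapply is_derive_continuity_pt; apply Hd.
  - lra.
  - exists z. split; [apply Rabs_def1; lra|]. split; [|exact Hzt].
    apply (proj2 HD (s - r) z (s + r)); [assumption|assumption|lra].
Qed.

(** The difference quotient of the inverse is [/ q], with [q] that of [H], and
    [/ q - / h s = (h s - q) / (q * h s)]. *)
Lemma is_derive_inverse_on (s : R) : D s ->
  is_derive (inverse_on D H) (H s) (/ h s).
Proof.
  intros Hs. apply is_derive_Reals. intros eps Heps.
  pose proof (Hp s Hs) as Hh.
  (* The first bound gives [q > h s / 2], hence a denominator above [h s ^ 2 / 2]; the second then
     makes the quotient smaller than [eps]. *)
  pose (e := Rmin (h s / 2) (eps * (h s) ^ 2 / 2)).
  assert (He : 0 < e).
  { apply Rmin_glb_lt; [lra|].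
    assert (0 < eps * (h s) ^ 2) by (apply Rmult_lt_0_compat; [lra|nra]). lra. }
  assert (He1 : e <= h s / 2) by apply Rmin_l.
  assert (He2 : e <= eps * (h s) ^ 2 / 2) by apply Rmin_r.
  destruct (proj1 (is_derive_Reals _ _ _) (Hd s) e He) as [eta Heta].
  destruct (image_nbhd s eta Hs (cond_pos eta)) as [del [Hdel Him]].
  exists (mkposreal del Hdel). intros k Hk0 Hk. simpl in Hk.
  destruct (Him (H s + k)) as [z [Hz [Dz HzH]]].
  { replace (H s + k - H s) with k by ring. exact Hk. }
  rewrite <- HzH, !inverse_onK by assumption.
  assert (Hm : z - s <> 0) by (intros E; apply Hk0; replace z with s in HzH by lra; lra).
  specialize (Heta (z - s) Hm Hz).
  replace (s + (z - s)) with z in Heta by ring.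
  replace (H z - H s) with k in Heta by lra.
  set (q := k / (z - s)) in *.
  apply Rabs_def2 in Heta.
  assert (Hq : h s / 2 < q) by lra.
  replace ((z - s) / k) with (/ q) by (unfold q; field; split; assumption).
  replace (/ q - / h s) with ((h s - q) / (q * h s)) by (field; lra).
  assert (Hqh : 0 < q * h s) by nra.
  assert (Hb : h s ^ 2 / 2 < q * h s) by nra.
  rewrite Rabs_div, (Rabs_pos_eq (q * h s)) by lra.
  apply (Rmult_lt_reg_r (q * h s)); [exact Hqh|].
  replace (Rabs (h s - q) / (q * h s) * (q * h s)) with (Rabs (h s - q)) by (field; lra).
  apply Rlt_le_trans with e; [apply Rabs_def1; lra|].
  nra.
Qed.

End InverseFunction.

(** * Functions that gain a fixed amount over each period *)

Lemma quasiperiodic_nat (H : R -> R) (P c : R) :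
  (forall s, H (s + P) = H s + c) ->
  forall (n : nat) s, H (s + INR n * P) = H s + INR n * c.
Proof.
  intros HP n s. induction n as [|n IH].
  - simpl. rewrite !Rmult_0_l, !Rplus_0_r. reflexivity.
  - rewrite S_INR. replace (s + (INR n + 1) * P) with (s + INR n * P + P) by ring.
    rewrite HP, IH. ring.
Qed.

Lemma quasiperiodic_Z (H : R -> R) (P c : R) :
  (forall s, H (s + P) = H s + c) ->
  forall (n : Z) s, H (s + IZR n * P) = H s + IZR n * c.
Proof.
  intros HP n s. destruct (Z_le_gt_dec 0 n) as [Hn|Hn].
  - rewrite <- (Z2Nat.id n Hn), <- INR_IZR_INZ. apply quasiperiodic_nat, HP.
  - rewrite <- (Z.opp_involutive n), <- (Z2Nat.id (- n)) by lia.
    rewrite opp_IZR, <- INR_IZR_INZ. set (k := Z.to_nat (- n)).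
    pose proof (quasiperiodic_nat H P c HP k (s + - INR k * P)) as E.
    replace (s + - INR k * P + INR k * P) with s in E by ring. lra.
Qed.

(** Over [m] periods on either side of [0], [H] moves by [m * c], which exceeds the distance from
    [H 0] to [t] for large [m]; intermediate values conclude. *)
Lemma quasiperiodic_surj (H : R -> R) (P c : R) :
  (forall s, continuity_pt H s) -> 0 < P -> 0 < c ->
  (forall s, H (s + P) = H s + c) -> forall t, exists s, H s = t.
Proof.
  intros Hc HP0 Hc0 HP t.
  destruct (nfloor_ex (Rabs (t - H 0) / c)) as [n [_ Hn]].
  { apply Rdiv_le_0_compat; [apply Rabs_pos|exact Hc0]. }
  assert (Hb : Rabs (t - H 0) < (INR n + 1) * c).
  { apply (Rmult_lt_compat_r c) in Hn; [|exact Hc0].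
    replace (Rabs (t - H 0) / c * c) with (Rabs (t - H 0)) in Hn by (field; lra).
    exact Hn. }
  rewrite <- S_INR in Hb. set (m := S n) in *.
  apply Rabs_def2 in Hb.
  pose proof (quasiperiodic_nat H P c HP m 0) as H1.
  pose proof (quasiperiodic_nat H P c HP m (- INR m * P)) as H2.
  rewrite Rplus_0_l in H1.
  replace (- INR m * P + INR m * P) with 0 in H2 by ring.
  pose proof (pos_INR m) as Hm.
  destruct (first_crossing H (- INR m * P) (INR m * P) t) as [s [_ [Hs _]]].
  - nra.
  - intros s _. apply Hc.
  - lra.
  - exists s. exact Hs.
Qed.

(** * The nonlinear oscillator and the Levi-Civita change of variables *)

Lemma cos_sqr_bound (t : R) : 0 <= cos t ^ 2 <= 1.
Proof.
  pose proof (sin2_cos2 t) as E. unfold Rsqr in E.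
  pose proof (pow2_ge_0 (sin t)). pose proof (pow2_ge_0 (cos t)). nra.
Qed.

(** A convex combination of [A] and [A - B]. The sign of [B] is left free: it is positive for [u]
    and negative for [v]. *)
Lemma osc_pos (A B t : R) : 0 < A -> 0 < A - B -> 0 < A - B * cos t ^ 2.
Proof.
  intros HA HB. pose proof (cos_sqr_bound t).
  replace (A - B * cos t ^ 2) with (A * (1 - cos t ^ 2) + (A - B) * cos t ^ 2) by ring.
  destruct (Rle_lt_dec (cos t ^ 2) (1 / 2)).
  - assert (0 <= (A - B) * cos t ^ 2) by (apply Rmult_le_pos; lra). nra.
  - assert (0 <= A * (1 - cos t ^ 2)) by (apply Rmult_le_pos; lra). nra.
Qed.

Lemma inv_sqrt_osc_derivable (A B t : R) : 0 < A -> 0 < A - B ->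
  ex_derive (fun s => / sqrt (A - B * cos s ^ 2)) t.
Proof.
  intros HA HB. pose proof (osc_pos A B t HA HB) as Hp.
  pose proof (sqrt_lt_R0 _ Hp) as Hs.
  auto_derive. split; [exact Hp|]. split; [|exact I].
  apply Rgt_not_eq. exact Hs.
Qed.

Lemma ex_RInt_osc (A B a b : R) : 0 < A -> 0 < A - B ->
  ex_RInt (fun s => / sqrt (A - B * cos s ^ 2)) a b.
Proof.
  intros HA HB. apply (ex_RInt_continuous (V := R_CompleteNormedModule)).
  intros z _. apply (ex_derive_continuous (fun s => / sqrt (A - B * cos s ^ 2))).
  apply inv_sqrt_osc_derivable; assumption.
Qed.

(** Time at which the phase reaches [t] when [phi' = sqrt (A - B * cos phi ^ 2)] starts from [0]: an
    incomplete elliptic integral, whose complete version is [quarter_period]. *)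
Definition osc_time (A B t : R) : R :=
  RInt (fun s => / sqrt (A - B * cos s ^ 2)) 0 t.

Definition quarter_period (A B : R) : R := osc_time A B (PI / 2).

Lemma is_derive_RInt_from_0 (f : R -> R) (t : R) :
  (forall s, continuous f s) -> is_derive (fun t => RInt f 0 t) t (f t).
Proof.
  intros Hf. apply (is_derive_RInt f (fun t => RInt f 0 t) 0 t); [|apply Hf].
  apply filter_forall. intros s. apply (RInt_correct f).
  apply (ex_RInt_continuous (V := R_CompleteNormedModule)). intros; apply Hf.
Qed.

Section Oscillator.
Variables (A B : R).
Hypotheses (HA : 0 < A) (HB : 0 < A - B).

Let S := osc_time A B.
Let K := quarter_period A B.
Let g t := sqrt (A - B * cos t ^ 2).

Lemma osc_speed_pos t : 0 < g t.
Proof. apply sqrt_lt_R0, osc_pos; assumption. Qed.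

Lemma is_derive_osc_time t : is_derive S t (/ g t).
Proof.
  unfold S, osc_time.
  apply (is_derive_RInt_from_0 (fun s => / sqrt (A - B * cos s ^ 2))).
  intros s. apply (ex_derive_continuous (fun s => / sqrt (A - B * cos s ^ 2))).
  apply inv_sqrt_osc_derivable; assumption.
Qed.

Lemma osc_time_0 : S 0 = 0.
Proof. apply (RInt_point (V := R_CompleteNormedModule)). Qed.

Lemma osc_time_incr s t : s < t -> S s < S t.
Proof.
  apply (increasing_of_derive_pos (fun _ => True) S (fun t => / g t)); trivial.
  - apply is_derive_osc_time.
  - intros z _. apply Rinv_0_lt_compat, osc_speed_pos.
Qed.

Lemma quarter_period_pos : 0 < K.
Proof.
  unfold K, quarter_period. fold S. rewrite <- osc_time_0.
  apply osc_time_incr. pose proof PI_RGT_0. lra.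
Qed.

Lemma osc_time_odd t : S (- t) = - S t.
Proof.
  assert (E : S (- t) + S t = S (- 0) + S 0).
  { apply (eq_of_derive_0 (fun t => S (- t) + S t)). intros s.
    replace 0 with (-1 * / g (- s) + / g s).
    - apply (is_derive_plus (fun t => S (- t)) S); [|apply is_derive_osc_time].
      apply (is_derive_comp S (fun t => - t)); [apply is_derive_osc_time|].
      auto_derive; [exact I|ring].
    - unfold g. rewrite cos_neg. ring. }
  rewrite Ropp_0, osc_time_0 in E. lra.
Qed.

(** [cos ^ 2] has period [PI], so the increment over [PI] is constant; at [- (PI / 2)] oddness
    evaluates it to [2 * K]. *)
Lemma osc_time_add_PI t : S (t + PI) = S t + 2 * K.
Proof.
  assert (E : forall t, S (t + PI) - S t = S (- (PI / 2) + PI) - S (- (PI / 2))).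
  { intros z. apply (eq_of_derive_0 (fun t => S (t + PI) - S t)). intros s.
    replace 0 with (1 * / g (s + PI) - / g s).
    - apply (is_derive_minus (fun t => S (t + PI)) S); [|apply is_derive_osc_time].
      apply (is_derive_comp S (fun t => t + PI)); [apply is_derive_osc_time|].
      auto_derive; [exact I|ring].
    - unfold g. rewrite neg_cos. replace ((- cos s) ^ 2) with (cos s ^ 2) by ring. ring. }
  specialize (E t). rewrite osc_time_odd in E.
  replace (- (PI / 2) + PI) with (PI / 2) in E by lra.
  unfold K, quarter_period. fold S. lra.
Qed.

Lemma osc_time_half_PI (n : Z) : S (IZR n * PI + PI / 2) = (2 * IZR n + 1) * K.
Proof.
  rewrite Rplus_comm, (quasiperiodic_Z S PI (2 * K) osc_time_add_PI).
  unfold K at 1 2, quarter_period. fold S. unfold K, quarter_period. fold S. ring.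
Qed.

Lemma osc_time_PI (n : Z) : S (IZR n * PI) = 2 * IZR n * K.
Proof.
  rewrite <- (Rplus_0_l (IZR n * PI)), (quasiperiodic_Z S PI (2 * K) osc_time_add_PI).
  rewrite osc_time_0. ring.
Qed.

(** The phase is the global inverse of the time integral, which is onto because it gains [2 * K]
    over each [PI]. *)
Lemma osc_phase : exists phi : R -> R,
  (forall t, phi (S t) = t) /\ (forall s, S (phi s) = s) /\
  (forall s, is_derive phi s (g (phi s))).
Proof.
  pose (D := fun _ : R => True).
  pose proof open_convex_True as HD. fold D in HD.
  assert (Hp : forall s, D s -> 0 < / g s) by (intros; apply Rinv_0_lt_compat, osc_speed_pos).
  exists (inverse_on D S).
  assert (H1 : forall t, inverse_on D S (S t) = t).
  { intros t. apply (inverse_onK D S (fun t => / g t)); try assumption.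
    - apply is_derive_osc_time.
    - exact I. }
  assert (Hsurj : forall s, exists t, S t = s).
  { apply (quasiperiodic_surj S PI (2 * K)).
    - intros s. eapply is_derive_continuity_pt, is_derive_osc_time.
    - apply PI_RGT_0.
    - pose proof quarter_period_pos. lra.
    - apply osc_time_add_PI. }
  split; [exact H1|]. split; intros s; destruct (Hsurj s) as [t <-]; rewrite H1.
  - reflexivity.
  - rewrite <- (Rinv_inv (g t)).
    apply (is_derive_inverse_on D S (fun t => / g t)); try assumption.
    + apply is_derive_osc_time.
    + exact I.
Qed.

End Oscillator.

(** The second derivative is a cubic polynomial in the position, so [w * cos phi] solves a Duffing
    equation, the form of both separated equations. *)
Lemma osc_position (A B w : R) (phi : R -> R) (s : R) :
  0 < A -> 0 < A - B ->
  (forall s, is_derive phi s (sqrt (A - B * cos (phi s) ^ 2))) ->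
  is_derive (fun s => w * cos (phi s)) s
    (- w * sin (phi s) * sqrt (A - B * cos (phi s) ^ 2)) /\
  is_derive (fun s => - w * sin (phi s) * sqrt (A - B * cos (phi s) ^ 2)) s
    (- (w * cos (phi s)) * (A + B - 2 * B * cos (phi s) ^ 2)).
Proof.
  intros HA HB Hphi.
  pose proof (osc_pos A B (phi s) HA HB) as Hp.
  pose proof (sqrt_lt_R0 _ Hp) as Hg.
  assert (Hd : Derive (fun z => phi z) s = sqrt (A - B * cos (phi s) ^ 2)).
  { apply is_derive_unique, Hphi. }
  assert (He : ex_derive phi s) by (eexists; apply Hphi).
  pose proof (sqrt_sqrt _ (Rlt_le _ _ Hp)) as Hsq.
  pose proof (sin2_cos2 (phi s)) as Hsc. unfold Rsqr in Hsc.
  split.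
  - auto_derive; [exact He|]. rewrite Hd. simpl. ring.
  - auto_derive.
    { repeat split; try exact He. unfold pow in Hp. exact Hp. }
    rewrite Hd.
    replace (A + - (B * (cos (phi s) * (cos (phi s) * 1)))) with (A - B * cos (phi s) ^ 2)
      by (simpl; ring).
    set (q := sqrt (A - B * cos (phi s) ^ 2)) in *.
    set (c := cos (phi s)) in *. set (z := sin (phi s)) in *.
    transitivity (- w * c * (q * q) - w * B * c * (z * z)).
    + field. lra.
    + rewrite Hsq. replace (z * z) with (1 - c * c) by lra. ring.
Qed.

(** * The Levi-Civita regularisation *)

Lemma is_derive_eq (f : R -> R) (t l l' : R) : is_derive f t l -> l = l' -> is_derive f t l'.
Proof. intros Hf <-. exact Hf. Qed.

(** Here [e] is minus the energy, and [H] is physical time as a function of the regularised time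
    [s]. On [D], where [u] and [v] do not vanish together, [H] can be inverted and the separated
    equations turn back into the Stark equations. *)
Lemma levi_civita (D : R -> Prop) (e : R) (H u v u1 v1 : R -> R) :
  open_convex D ->
  (forall s, is_derive H s (u s ^ 2 + v s ^ 2)) ->
  (forall s, is_derive u s (u1 s)) -> (forall s, is_derive v s (v1 s)) ->
  (forall s, is_derive u1 s (- 2 * e * u s + 2 * u s ^ 3)) ->
  (forall s, is_derive v1 s (- 2 * e * v s - 2 * v s ^ 3)) ->
  (forall s, u1 s ^ 2 + v1 s ^ 2 = 4 + u s ^ 4 - v s ^ 4 - 2 * e * (u s ^ 2 + v s ^ 2)) ->
  (forall s, D s -> 0 < u s ^ 2 + v s ^ 2) ->
  exists x y : R -> R,
    stark_sol_on (fun t => exists s, D s /\ H s = t) x y /\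
    forall s, D s ->
      x (H s) = (u s ^ 2 - v s ^ 2) / 2 /\ y (H s) = u s * v s /\
      Derive x (H s) = (u s * u1 s - v s * v1 s) / (u s ^ 2 + v s ^ 2) /\
      Derive y (H s) = (u1 s * v s + u s * v1 s) / (u s ^ 2 + v s ^ 2).
Proof.
  intros HD HH Hu Hv Hu1 Hv1 He Hp.
  pose (h := fun s => u s ^ 2 + v s ^ 2).
  pose (G := inverse_on D H).
  assert (GH : forall s, D s -> G (H s) = s).
  { intros s Hs. apply (inverse_onK D H h); assumption. }
  assert (dG : forall s, D s -> is_derive G (H s) (/ h s)).
  { intros s Hs. apply (is_derive_inverse_on D H h); assumption. }
  assert (dcomp : forall (f : R -> R) l s, D s -> is_derive f s l ->
            is_derive (fun t => f (G t)) (H s) (l / h s)).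
  { intros f l s Hs Hf.
    apply (is_derive_eq _ _ (/ h s * l)); [|unfold Rdiv; ring].
    apply (is_derive_comp f G); [rewrite GH by exact Hs; exact Hf|apply dG, Hs]. }
  pose (X := fun s => (u s ^ 2 - v s ^ 2) / 2).
  pose (Y := fun s => u s * v s).
  pose (X1 := fun s => (u s * u1 s - v s * v1 s) / (u s ^ 2 + v s ^ 2)).
  pose (Y1 := fun s => (u1 s * v s + u s * v1 s) / (u s ^ 2 + v s ^ 2)).
  assert (dux : forall s, Derive (fun z => u z) s = u1 s) by (intros; apply is_derive_unique, Hu).
  assert (dvx : forall s, Derive (fun z => v z) s = v1 s) by (intros; apply is_derive_unique, Hv).
  assert (du1x : forall s, Derive (fun z => u1 z) s = - 2 * e * u s + 2 * u s ^ 3)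
    by (intros; apply is_derive_unique, Hu1).
  assert (dv1x : forall s, Derive (fun z => v1 z) s = - 2 * e * v s - 2 * v s ^ 3)
    by (intros; apply is_derive_unique, Hv1).
  assert (eu : forall s, ex_derive u s) by (intros; eexists; apply Hu).
  assert (ev : forall s, ex_derive v s) by (intros; eexists; apply Hv).
  assert (eu1 : forall s, ex_derive u1 s) by (intros; eexists; apply Hu1).
  assert (ev1 : forall s, ex_derive v1 s) by (intros; eexists; apply Hv1).
  assert (dX : forall s, is_derive X s (u s * u1 s - v s * v1 s)).
  { intros s. unfold X. auto_derive; [auto|]. rewrite dux, dvx. field. }
  assert (dY : forall s, is_derive Y s (u1 s * v s + u s * v1 s)).
  { intros s. unfold Y. auto_derive; [auto|]. rewrite dux, dvx. ring. }
  (* [Derive x] is known only at times in the image of [D], so differentiating it again requires the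
     image to be a neighbourhood of each of its points. *)
  assert (Gin : forall s, D s -> locally (H s) (fun t => exists z, D z /\ H z = t)).
  { intros s Hs.
    destruct (image_nbhd D H h HD HH Hp s 1 Hs Rlt_0_1) as [eps [Heps Him]].
    exists (mkposreal eps Heps). intros t Ht.
    destruct (Him t Ht) as [z [_ [Dz Hz]]]. exists z. split; assumption. }
  assert (Dx : forall s, D s -> Derive (fun t => X (G t)) (H s) = X1 s).
  { intros s Hs. apply is_derive_unique, dcomp; [exact Hs|apply dX]. }
  assert (Dy : forall s, D s -> Derive (fun t => Y (G t)) (H s) = Y1 s).
  { intros s Hs. apply is_derive_unique, dcomp; [exact Hs|apply dY]. }
  exists (fun t => X (G t)), (fun t => Y (G t)). split.
  - intros t [s [Hs <-]].
    assert (Hr : rad (X (G (H s))) (Y (G (H s))) = h s / 2).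
    { rewrite GH by exact Hs. unfold rad, X, Y, h.
      apply sqrt_lem_1.
      - nra.
      - specialize (Hp s Hs). lra.
      - field. }
    pose proof (Hp s Hs) as Hh. fold (h s) in Hh.
    split; [rewrite Hr; lra|].
    split; [eexists; apply dcomp; [exact Hs|apply dX]|].
    split; [eexists; apply dcomp; [exact Hs|apply dY]|].
    rewrite Hr, GH by exact Hs. unfold h in Hh |- *.
    split.
    + apply (is_derive_ext_loc (fun t => X1 (G t))).
      { apply (filter_imp (fun t => exists z, D z /\ H z = t)); [|apply Gin, Hs].
        intros t [z [Hz <-]]. rewrite Dx, GH by exact Hz. reflexivity. }
      refine (is_derive_eq _ _ _ _ (dcomp X1 _ s Hs _) _).
      { unfold X1. auto_derive; [repeat split; auto; simpl in Hh; lra|reflexivity]. }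
      rewrite dux, dvx, du1x, dv1x. unfold X, h. specialize (He s).
      (* The velocities now enter only through [u1 ^ 2 + v1 ^ 2], which the energy relation [He]
         eliminates. *)
      transitivity (((v s ^ 2 - u s ^ 2) * (u1 s ^ 2 + v1 s ^ 2) + (u s ^ 2 + v s ^ 2) *
        (- 2 * e * (u s ^ 2 - v s ^ 2) + 2 * (u s ^ 4 + v s ^ 4))) / (u s ^ 2 + v s ^ 2) ^ 3).
      { field. simpl in Hh |- *. lra. }
      rewrite He. field. simpl in Hh |- *. lra.
    + apply (is_derive_ext_loc (fun t => Y1 (G t))).
      { apply (filter_imp (fun t => exists z, D z /\ H z = t)); [|apply Gin, Hs].
        intros t [z [Hz <-]]. rewrite Dy, GH by exact Hz. reflexivity. }
      refine (is_derive_eq _ _ _ _ (dcomp Y1 _ s Hs _) _).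
      { unfold Y1. auto_derive; [repeat split; auto; simpl in Hh; lra|reflexivity]. }
      rewrite dux, dvx, du1x, dv1x. unfold Y, h. specialize (He s).
      transitivity ((- 2 * u s * v s * (u1 s ^ 2 + v1 s ^ 2) + (u s ^ 2 + v s ^ 2) *
        (- 4 * e * u s * v s + 2 * u s ^ 3 * v s - 2 * u s * v s ^ 3)) /
        (u s ^ 2 + v s ^ 2) ^ 3).
      { field. simpl in Hh |- *. lra. }
      rewrite He. field. simpl in Hh |- *. lra.
  - intros s Hs. rewrite Dx, Dy, GH by exact Hs. repeat split.
Qed.

(** * Brake and collision orbits from commensurable phases *)

Lemma phase_incr (A B : R) (phi : R -> R) :
  0 < A -> 0 < A - B -> (forall s, osc_time A B (phi s) = s) ->
  forall s t, s < t -> phi s < phi t.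
Proof.
  intros HA HB HS s t Hst. destruct (Rlt_le_dec (phi s) (phi t)) as [|[Hlt|Heq]].
  - assumption.
  - apply (osc_time_incr A B HA HB) in Hlt. rewrite !HS in Hlt. lra.
  - apply (f_equal (osc_time A B)) in Heq. rewrite !HS in Heq. lra.
Qed.

Lemma cos_phase_eq_0 (A B : R) (phi : R -> R) (s : R) :
  0 < A -> 0 < A - B -> (forall s, osc_time A B (phi s) = s) ->
  cos (phi s) = 0 -> exists n : Z, s = (2 * IZR n + 1) * quarter_period A B.
Proof.
  intros HA HB HS Hc. destruct (cos_eq_0_0 _ Hc) as [n Hn]. exists n.
  rewrite <- (HS s), Hn. apply osc_time_half_PI; assumption.
Qed.

Lemma phase_shift (A B : R) (phi : R -> R) (n : nat) (s : R) :
  0 < A -> 0 < A - B -> (forall s, osc_time A B (phi s) = s) ->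
  (forall t, phi (osc_time A B t) = t) ->
  phi (s + 4 * INR n * quarter_period A B) = phi s + 2 * INR n * PI.
Proof.
  intros HA HB HS HS'.
  rewrite <- (HS' (phi s + 2 * INR n * PI)). f_equal.
  replace (2 * INR n * PI) with (INR (2 * n) * PI)
    by (rewrite mult_INR; simpl; ring).
  rewrite (quasiperiodic_nat _ PI (2 * quarter_period A B)
             (osc_time_add_PI A B HA HB)).
  rewrite HS, mult_INR. simpl. ring.
Qed.

(* [u_period r a] and [v_period r a] are the quarter periods of the two
   Levi-Civita coordinates for an orbit at rest at distance [r] and abscissa [a];
   the energy is [- (/ r + a)]. *)
Definition u_period (r a : R) : R := quarter_period (2 / r + a - r) (r + a).
Definition v_period (r a : R) : R := quarter_period (2 / r + a + r) (a - r).

Section Orbit.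
Variables (r a : R) (phi psi : R -> R).
Hypotheses (Hr : 0 < r < 1) (Ha : -1 < a) (Hra : -r < a < r).

(** In regularised time [u' ^ 2 = (u0 ^ 2 - u ^ 2) * (Au - u ^ 2)] and
    [v' ^ 2 = (v0 ^ 2 - v ^ 2) * (Av + v ^ 2)], with [u0 ^ 2 = Bu] and [v0 ^ 2 = - Bv]. Substituting
    [u = u0 * cos phi] and [v = v0 * cos psi] leaves the phase equations below. *)
Let Au := 2 / r + a - r.
Let Bu := r + a.
Let Av := 2 / r + a + r.
Let Bv := a - r.
Let Ku := u_period r a.
Let Kv := v_period r a.

Hypothesis phi_time : forall t, phi (osc_time Au Bu t) = t.
Hypothesis time_phi : forall s, osc_time Au Bu (phi s) = s.
Hypothesis dphi : forall s, is_derive phi s (sqrt (Au - Bu * cos (phi s) ^ 2)).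
Hypothesis psi_time : forall t, psi (osc_time Av Bv t) = t.
Hypothesis time_psi : forall s, osc_time Av Bv (psi s) = s.
Hypothesis dpsi : forall s, is_derive psi s (sqrt (Av - Bv * cos (psi s) ^ 2)).

(** The amplitudes put the orbit at abscissa [a] and distance [r] when both phases are zero, where
    both derivatives vanish. *)
Let u s := sqrt (r + a) * cos (phi s).
Let v s := sqrt (r - a) * cos (psi s).
Let u1 s := - sqrt (r + a) * sin (phi s) * sqrt (Au - Bu * cos (phi s) ^ 2).
Let v1 s := - sqrt (r - a) * sin (psi s) * sqrt (Av - Bv * cos (psi s) ^ 2).
Let H s := RInt (fun s => u s ^ 2 + v s ^ 2) 0 s.

Lemma two_div_r : 2 < 2 / r.
Proof.
  apply (Rmult_lt_reg_r r); [lra|]. replace (2 / r * r) with 2 by (field; lra). lra.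
Qed.

Lemma Au_pos : 0 < Au.
Proof. pose proof two_div_r. unfold Au. lra. Qed.
Lemma Bu_lt : 0 < Au - Bu.
Proof. pose proof two_div_r. unfold Au, Bu. lra. Qed.
Lemma Av_pos : 0 < Av.
Proof. pose proof two_div_r. unfold Av. lra. Qed.
Lemma Bv_lt : 0 < Av - Bv.
Proof. pose proof two_div_r. unfold Av, Bv. lra. Qed.
Lemma Ku_pos : 0 < Ku.
Proof. apply quarter_period_pos; [apply Au_pos|apply Bu_lt]. Qed.
Lemma Kv_pos : 0 < Kv.
Proof. apply quarter_period_pos; [apply Av_pos|apply Bv_lt]. Qed.

Lemma u0_sqr : sqrt (r + a) ^ 2 = r + a.
Proof. apply pow2_sqrt. lra. Qed.
Lemma v0_sqr : sqrt (r - a) ^ 2 = r - a.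
Proof. apply pow2_sqrt. lra. Qed.
Lemma u0_pos : 0 < sqrt (r + a).
Proof. apply sqrt_lt_R0. lra. Qed.
Lemma v0_pos : 0 < sqrt (r - a).
Proof. apply sqrt_lt_R0. lra. Qed.

Lemma is_derive_u s : is_derive u s (u1 s).
Proof. apply (osc_position Au Bu); [apply Au_pos|apply Bu_lt|apply dphi]. Qed.
Lemma is_derive_v s : is_derive v s (v1 s).
Proof. apply (osc_position Av Bv); [apply Av_pos|apply Bv_lt|apply dpsi]. Qed.

Lemma is_derive_u1 s : is_derive u1 s (- 2 * (/ r + a) * u s + 2 * u s ^ 3).
Proof.
  eapply is_derive_eq.
  - apply (osc_position Au Bu); [apply Au_pos|apply Bu_lt|apply dphi].
  - unfold u. rewrite Rpow_mult_distr. unfold Au, Bu.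
    replace (sqrt (r + a) ^ 3) with ((r + a) * sqrt (r + a))
      by (rewrite <- u0_sqr at 1; ring).
    field. lra.
Qed.

Lemma is_derive_v1 s : is_derive v1 s (- 2 * (/ r + a) * v s - 2 * v s ^ 3).
Proof.
  eapply is_derive_eq.
  - apply (osc_position Av Bv); [apply Av_pos|apply Bv_lt|apply dpsi].
  - unfold v. rewrite Rpow_mult_distr. unfold Av, Bv.
    replace (sqrt (r - a) ^ 3) with ((r - a) * sqrt (r - a))
      by (rewrite <- v0_sqr at 1; ring).
    field. lra.
Qed.

(** Adding the two factored forms, the constant terms give [(r + a) * Au + (r - a) * Av = 4]. *)
Lemma uv_energy s :
  u1 s ^ 2 + v1 s ^ 2 = 4 + u s ^ 4 - v s ^ 4 - 2 * (/ r + a) * (u s ^ 2 + v s ^ 2).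
Proof.
  unfold u, v, u1, v1.
  pose proof (osc_pos Au Bu (phi s) Au_pos Bu_lt) as Hp.
  pose proof (osc_pos Av Bv (psi s) Av_pos Bv_lt) as Hq.
  pose proof (sin2_cos2 (phi s)) as E1. pose proof (sin2_cos2 (psi s)) as E2.
  unfold Rsqr in E1, E2.
  rewrite !Rpow_mult_distr.
  rewrite (pow2_sqrt (Au - _)), (pow2_sqrt (Av - _)) by lra.
  replace ((- sqrt (r + a)) ^ 2) with (sqrt (r + a) ^ 2) by ring.
  replace ((- sqrt (r - a)) ^ 2) with (sqrt (r - a) ^ 2) by ring.
  replace (sqrt (r + a) ^ 4) with ((sqrt (r + a) ^ 2) ^ 2) by ring.
  replace (sqrt (r - a) ^ 4) with ((sqrt (r - a) ^ 2) ^ 2) by ring.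
  rewrite u0_sqr, v0_sqr.
  replace (sin (phi s) ^ 2) with (1 - cos (phi s) ^ 2) by (simpl; lra).
  replace (sin (psi s) ^ 2) with (1 - cos (psi s) ^ 2) by (simpl; lra).
  unfold Au, Av, Bu, Bv. field. lra.
Qed.

Lemma is_derive_time s : is_derive H s (u s ^ 2 + v s ^ 2).
Proof.
  refine (is_derive_RInt_from_0 (fun s => u s ^ 2 + v s ^ 2) s _). intros z.
  apply (ex_derive_continuous (fun s => u s ^ 2 + v s ^ 2)).
  assert (ex_derive u z) by (eexists; apply is_derive_u).
  assert (ex_derive v z) by (eexists; apply is_derive_v).
  auto_derive. auto.
Qed.

Lemma time_continuous s : continuity_pt H s.
Proof. eapply is_derive_continuity_pt, is_derive_time. Qed.

Lemma time_0 : H 0 = 0.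
Proof. apply (RInt_point (V := R_CompleteNormedModule)). Qed.

Lemma phi_0 : phi 0 = 0.
Proof. rewrite <- (osc_time_0 Au Bu) at 1. apply phi_time. Qed.
Lemma psi_0 : psi 0 = 0.
Proof. rewrite <- (osc_time_0 Av Bv) at 1. apply psi_time. Qed.

Lemma phi_Ku : phi Ku = PI / 2.
Proof. apply phi_time. Qed.

Lemma psi_half_PI (n : nat) : psi ((2 * INR n + 1) * Kv) = INR n * PI + PI / 2.
Proof.
  rewrite INR_IZR_INZ. rewrite <- psi_time. f_equal. symmetry.
  apply osc_time_half_PI; [apply Av_pos|apply Bv_lt].
Qed.

Lemma psi_PI (n : nat) : psi (2 * INR n * Kv) = INR n * PI.
Proof.
  rewrite INR_IZR_INZ. rewrite <- psi_time. f_equal. symmetry.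
  apply osc_time_PI; [apply Av_pos|apply Bv_lt].
Qed.

Lemma u_pos s : - Ku < s < Ku -> 0 < u s.
Proof.
  intros Hs. apply Rmult_lt_0_compat; [apply u0_pos|].
  pose proof (phase_incr Au Bu phi Au_pos Bu_lt time_phi) as Hinc.
  apply cos_gt_0.
  - replace (- (PI / 2)) with (phi (- Ku)).
    + apply Hinc; lra.
    + unfold Ku, u_period, quarter_period. fold Au Bu.
      rewrite <- osc_time_odd by (apply Au_pos || apply Bu_lt). apply phi_time.
  - rewrite <- phi_Ku. apply Hinc. lra.
Qed.

Lemma u_Ku : u Ku = 0.
Proof. unfold u. rewrite phi_Ku, cos_PI2. ring. Qed.

Lemma speed_pos s : - Ku < s < Ku -> 0 < u s ^ 2 + v s ^ 2.
Proof. intros Hs. pose proof (u_pos s Hs). nra. Qed.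

Lemma time_incr s t : - Ku <= s -> s < t -> t <= Ku -> H s < H t.
Proof.
  intros Hs Hst Ht. apply (lt_of_derive_pos H (fun s => u s ^ 2 + v s ^ 2)).
  - apply is_derive_time.
  - exact Hst.
  - intros z Hz. apply speed_pos. lra.
Qed.

Lemma time_between s s' t : - Ku <= s -> s < s' -> s' <= Ku -> H s < t < H s' ->
  exists z, s < z < s' /\ H z = t.
Proof.
  intros Hs Hss Hs' Ht.
  destruct (first_crossing H s s' t) as [z [Hz [Hzt _]]].
  - lra.
  - intros z _. apply time_continuous.
  - lra.
  - exists z. split; [|exact Hzt]. split; [lra|].
    destruct (Req_dec z s') as [->|]; lra.
Qed.

Lemma v_zero (n : nat) : v ((2 * INR n + 1) * Kv) = 0.
Proof.
  unfold v. rewrite psi_half_PI, cos_eq_0_1; [ring|].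
  exists (Z.of_nat n). rewrite INR_IZR_INZ. reflexivity.
Qed.

(** Since [u > 0] before [Ku], [y = u * v] vanishes only with [v], where [x = u ^ 2 / 2 > 0]. The
    zeros of [v] are the odd multiples of [Kv], and exactly [k] positive ones lie below [m * Kv] for
    either value of [m]; in the odd case the next one is the excluded endpoint [Ku]. *)
Lemma axis_crossings (k m : nat) (x y : R -> R) :
  (m = 2 * k \/ m = 2 * k + 1)%nat -> Ku = INR m * Kv ->
  (forall s, - Ku < s < Ku ->
     x (H s) = (u s ^ 2 - v s ^ 2) / 2 /\ y (H s) = u s * v s) ->
  exactly_n_times (fun t => 0 < t < H Ku /\ y t = 0 /\ 0 < x t) k /\
  (forall t, 0 < t < H Ku -> y t = 0 -> 0 < x t).
Proof.
  intros Hm HK Hxy.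
  pose proof Ku_pos as HKu. pose proof Kv_pos as HKv.
  assert (Hsolve : forall t, 0 < t < H Ku -> exists s, 0 < s < Ku /\ H s = t).
  { intros t Ht. apply time_between; [lra|lra|lra|]. rewrite time_0. exact Ht. }
  assert (Hx : forall s, - Ku < s < Ku -> v s = 0 -> 0 < x (H s)).
  { intros s Hs Hv. rewrite (proj1 (Hxy s Hs)), Hv. pose proof (u_pos s Hs). nra. }
  assert (Hv0 : forall s, - Ku < s < Ku -> y (H s) = 0 -> v s = 0).
  { intros s Hs Hy. rewrite (proj2 (Hxy s Hs)) in Hy.
    pose proof (u_pos s Hs). apply Rmult_integral in Hy. destruct Hy; [lra|assumption]. }
  assert (Hj : forall j, (j < k)%nat -> 0 < (2 * INR j + 1) * Kv < Ku).
  { intros j Hjk. pose proof (pos_INR j). split; [apply Rmult_lt_0_compat; lra|].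
    rewrite HK. apply Rmult_lt_compat_r; [lra|].
    replace (2 * INR j + 1) with (INR (2 * j + 1))
      by (rewrite plus_INR, mult_INR; simpl; ring).
    apply lt_INR. lia. }
  split.
  - exists (map (fun j => H ((2 * INR j + 1) * Kv)) (seq 0 k)).
    split; [|split].
    + apply Injective_map_NoDup_in; [|apply seq_NoDup].
      intros i j Hi Hj' Heq. apply in_seq in Hi, Hj'.
      pose proof (Hj i ltac:(lia)) as Hi1. pose proof (Hj j ltac:(lia)) as Hj1.
      assert (Hlt : forall p q : nat, (p < q)%nat ->
                (2 * INR p + 1) * Kv < (2 * INR q + 1) * Kv).
      { intros p q Hpq. apply lt_INR in Hpq. apply Rmult_lt_compat_r; lra. }
      destruct (Nat.lt_total i j) as [Hij|[Hij|Hij]]; [|exact Hij|];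
        apply Hlt in Hij; apply time_incr in Hij; lra.
    + rewrite length_map, length_seq. reflexivity.
    + intros t. rewrite in_map_iff. split.
      * intros [j [<- Hjk]]. apply in_seq in Hjk.
        pose proof (Hj j ltac:(lia)) as Hj1.
        rewrite (proj2 (Hxy ((2 * INR j + 1) * Kv) ltac:(lra))), v_zero.
        split; [|split; [ring|apply Hx; [lra|apply v_zero]]].
        rewrite <- time_0 at 1. split; apply time_incr; lra.
      * intros [Ht [Hy _]]. destruct (Hsolve t Ht) as [s [Hs <-]].
        apply Hv0 in Hy; [|lra]. unfold v in Hy.
        apply Rmult_integral in Hy. destruct Hy as [Hy|Hy].
        { pose proof v0_pos. lra. }
        destruct (cos_phase_eq_0 Av Bv psi s Av_pos Bv_lt time_psi Hy) as [n Hn].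
        change (quarter_period Av Bv) with Kv in Hn.
        assert (H1 : (0 < 2 * n + 1)%Z).
        { apply lt_IZR. rewrite plus_IZR, mult_IZR. simpl.
          apply (Rmult_lt_reg_r Kv); lra. }
        assert (H2 : (2 * n + 1 < Z.of_nat m)%Z).
        { apply lt_IZR. rewrite plus_IZR, mult_IZR, <- INR_IZR_INZ. simpl.
          apply (Rmult_lt_reg_r Kv); lra. }
        exists (Z.to_nat n). split; [|apply in_seq; lia].
        rewrite INR_IZR_INZ, Z2Nat.id, <- Hn by lia. reflexivity.
  - intros t Ht Hy. destruct (Hsolve t Ht) as [s [Hs <-]].
    apply Hx; [lra|]. apply Hv0; [lra|exact Hy].
Qed.

Lemma initial_state (D : R -> Prop) (x y : R -> R) (d : R) :
  0 < d -> r = rad a d -> D 0 ->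
  (forall s, D s ->
      x (H s) = (u s ^ 2 - v s ^ 2) / 2 /\ y (H s) = u s * v s /\
      Derive x (H s) = (u s * u1 s - v s * v1 s) / (u s ^ 2 + v s ^ 2) /\
      Derive y (H s) = (u1 s * v s + u s * v1 s) / (u s ^ 2 + v s ^ 2)) ->
  init_rest x y a d.
Proof.
  intros Hd Hrad HD0 Hxy. destruct (Hxy 0 HD0) as [Hx [Hy [Hx1 Hy1]]].
  rewrite time_0 in Hx, Hy, Hx1, Hy1.
  unfold init_rest. rewrite Hx, Hy, Hx1, Hy1.
  unfold u, v, u1, v1. rewrite phi_0, psi_0, cos_0, sin_0.
  rewrite !Rmult_1_r, u0_sqr, v0_sqr. repeat split.
  - field.
  - rewrite <- sqrt_mult by lra.
    replace ((r + a) * (r - a)) with (d ^ 2).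
    + apply sqrt_pow2. lra.
    + assert (E : r ^ 2 = a ^ 2 + d ^ 2).
      { rewrite Hrad. unfold rad. apply pow2_sqrt. nra. }
      simpl in *; lra.
  - field. lra.
  - field. lra.
Qed.

(** As [Ku] is an odd multiple of [Kv], [u] and [v] vanish together at [Ku], so [x] and [y] tend to
    [0]. The solution lives on [- Ku < s < Ku], where [u > 0] keeps it away from the origin. *)
Lemma collision_of_phases (d : R) (k : nat) :
  0 < d -> r = rad a d -> Ku = INR (2 * k + 1) * Kv -> collision_orbit_k a d k.
Proof.
  intros Hd Hrad HK. pose proof Ku_pos as HKu.
  pose (D := fun s => - Ku < s < Ku).
  assert (HD : open_convex D).
  { split.
    - intros s Hs. unfold D in *. exists (Rmin (s + Ku) (Ku - s) / 2).
      pose proof (Rmin_l (s + Ku) (Ku - s)). pose proof (Rmin_r (s + Ku) (Ku - s)).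
      assert (0 < Rmin (s + Ku) (Ku - s)) by (apply Rmin_glb_lt; lra).
      split; [lra|]. intros z Hz. apply Rabs_le_between in Hz. lra.
    - unfold D. intros; lra. }
  destruct (levi_civita D (/ r + a) H u v u1 v1 HD is_derive_time is_derive_u is_derive_v is_derive_u1 is_derive_v1 uv_energy speed_pos)
    as [x [y [Hsol Hxy]]].
  exists x, y, (H (- Ku)), (H Ku).
  assert (HH0 : H (- Ku) < 0 < H Ku).
  { rewrite <- time_0 at 1 2. split; apply time_incr; lra. }
  assert (HvK : v Ku = 0) by (rewrite HK, plus_INR, mult_INR; apply v_zero).
  (* Limits from the left are computed in regularised time: a [t] just below [H Ku] is [H z] for
     some [z] just below [Ku]. *)
  assert (Hlim : forall (f F : R -> R), (forall s, D s -> f (H s) = F s) ->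
            continuity_pt F Ku -> F Ku = 0 -> filterlim f (at_left (H Ku)) (locally 0)).
  { intros f F Hf Hc HF0. apply filterlim_locally. intros eps.
    destruct (continuity_pt_eps F Ku eps Hc (cond_pos eps)) as [eta [Heta Hn]].
    pose (s0 := Rmax 0 (Ku - eta / 2)).
    assert (Hs0 : 0 <= s0 < Ku) by (split; [apply Rmax_l|apply Rmax_lub_lt; lra]).
    assert (Hs0' : Ku - eta / 2 <= s0) by apply Rmax_r.
    assert (Hlt : H s0 < H Ku) by (apply time_incr; lra).
    exists (mkposreal (H Ku - H s0) (Rlt_Rminus _ _ Hlt)).
    intros t Ht HtK. change (Rabs (t - H Ku) < H Ku - H s0) in Ht.
    apply Rabs_def2 in Ht.
    destruct (time_between s0 Ku t) as [z [Hz <-]]; [lra|lra|lra|lra|].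
    rewrite Hf by (unfold D; lra).
    change (Rabs (F z - 0) < eps). rewrite <- HF0. apply Hn. apply Rabs_def1; lra. }
  assert (eu : ex_derive u Ku) by (eexists; apply is_derive_u).
  assert (ev : ex_derive v Ku) by (eexists; apply is_derive_v).
  split; [exact HH0|]. split; [|split; [|split; [|split]]].
  - intros t Ht. apply Hsol. destruct (time_between (- Ku) Ku t) as [z [Hz Hzt]]; try lra.
    exists z. split; assumption.
  - apply (initial_state D); try assumption. unfold D. lra.
  - apply (Hlim x (fun s => (u s ^ 2 - v s ^ 2) / 2)).
    + intros s Hs. apply Hxy, Hs.
    + apply continuity_pt_filterlim.
      apply (ex_derive_continuous (fun s => (u s ^ 2 - v s ^ 2) / 2)). auto_derive. auto.
    + rewrite u_Ku, HvK. field.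
  - apply (Hlim y (fun s => u s * v s)).
    + intros s Hs. apply Hxy, Hs.
    + apply continuity_pt_filterlim.
      apply (ex_derive_continuous (fun s => u s * v s)). auto_derive. auto.
    + rewrite u_Ku. ring.
  - apply (axis_crossings k (2 * k + 1)); [lia|exact HK|].
    intros s Hs. destruct (Hxy s Hs) as [? [? _]]. split; assumption.
Qed.

(** As [Ku] is an even multiple of [Kv], the orbit never collides and has regularised period
    [4 * Ku]. At [Ku] the coordinate [u] vanishes, and [psi = k * PI] makes [v1] vanish, so [x'],
    proportional to [u * u1 - v * v1], is zero there. *)
Lemma brake_of_phases (d : R) (k : nat) :
  0 < d -> r = rad a d -> Ku = INR (2 * k) * Kv -> brake_orbit_k a d k.
Proof.
  intros Hd Hrad HK. pose proof Ku_pos as HKu. pose proof Kv_pos as HKv.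
  pose (D := fun _ : R => True).
  pose proof open_convex_True as HD. fold D in HD.
  (* [u] vanishes only at even multiples of [Kv] and [v] only at odd ones. *)
  assert (Hp : forall s, D s -> 0 < u s ^ 2 + v s ^ 2).
  { intros s _. pose proof (pow2_ge_0 (u s)) as H1. pose proof (pow2_ge_0 (v s)) as H2.
    destruct (Rle_lt_or_eq_dec 0 (u s ^ 2 + v s ^ 2) ltac:(lra)) as [|E]; [assumption|].
    exfalso.
    assert (Eu : u s = 0) by (apply Rsqr_0_uniq; unfold Rsqr; lra).
    assert (Ev : v s = 0) by (apply Rsqr_0_uniq; unfold Rsqr; lra).
    unfold u in Eu; unfold v in Ev.
    apply Rmult_integral in Eu, Ev. pose proof u0_pos. pose proof v0_pos.
    destruct Eu as [Eu|Eu]; [lra|]. destruct Ev as [Ev|Ev]; [lra|].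
    destruct (cos_phase_eq_0 Au Bu phi s Au_pos Bu_lt time_phi Eu) as [i Hi].
    destruct (cos_phase_eq_0 Av Bv psi s Av_pos Bv_lt time_psi Ev) as [j Hj].
    change (quarter_period Au Bu) with Ku in Hi. change (quarter_period Av Bv) with Kv in Hj.
    rewrite HK in Hi. rewrite Hi, <- Rmult_assoc in Hj.
    apply Rmult_eq_reg_r in Hj; [|lra].
    rewrite INR_IZR_INZ in Hj.
    assert (E' : ((2 * i + 1) * Z.of_nat (2 * k) = 2 * j + 1)%Z).
    { apply eq_IZR. rewrite mult_IZR, !plus_IZR, !mult_IZR. exact Hj. }
    rewrite Nat2Z.inj_mul in E'. change (Z.of_nat 2) with 2%Z in E'.
    assert (2 * ((2 * i + 1) * Z.of_nat k) = 2 * j + 1)%Z by (rewrite <- E'; ring).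
    lia. }
  destruct (levi_civita D (/ r + a) H u v u1 v1 HD is_derive_time is_derive_u is_derive_v is_derive_u1 is_derive_v1 uv_energy Hp)
    as [x [y [Hsol Hxy]]].
  assert (Hk : (0 < k)%nat).
  { destruct k; [|lia]. simpl in HK. lra. }
  assert (Hu : forall s, u (s + 4 * Ku) = u s).
  { intros s. unfold u. f_equal.
    pose proof (phase_shift Au Bu phi 1 s Au_pos Bu_lt time_phi phi_time) as E.
    change (quarter_period Au Bu) with Ku in E.
    replace (4 * INR 1 * Ku) with (4 * Ku) in E by (simpl; ring).
    rewrite E. apply cos_period. }
  assert (Hv : forall s, v (s + 4 * Ku) = v s).
  { intros s. unfold v. f_equal.
    pose proof (phase_shift Av Bv psi (2 * k) s Av_pos Bv_lt time_psi psi_time) as E.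
    change (quarter_period Av Bv) with Kv in E.
    replace (4 * INR (2 * k) * Kv) with (4 * Ku) in E by (rewrite HK; ring).
    rewrite E. apply cos_period. }
  (* Periodicity of [u ^ 2 + v ^ 2] makes physical time gain [H (4 * Ku)] over each period; this is
     the period of the orbit, and it makes [H] onto. *)
  assert (HP : forall s, H (s + 4 * Ku) = H s + H (4 * Ku)).
  { intros s.
    assert (E : H (s + 4 * Ku) - H s = H (0 + 4 * Ku) - H 0).
    { apply (eq_of_derive_0 (fun s => H (s + 4 * Ku) - H s)). intros z.
      eapply is_derive_eq.
      - apply (is_derive_minus (fun s => H (s + 4 * Ku)) H); [|apply is_derive_time].
        apply (is_derive_comp H (fun s => s + 4 * Ku)); [apply is_derive_time|].
        auto_derive; [exact I|reflexivity].
      - rewrite Hu, Hv. unfold scal, minus, plus, opp; simpl. unfold mult; simpl. ring. }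
    rewrite Rplus_0_l, time_0 in E. lra. }
  assert (HP0 : 0 < H (4 * Ku)).
  { rewrite <- time_0. apply (lt_of_derive_pos H (fun s => u s ^ 2 + v s ^ 2)); [apply is_derive_time|lra|].
    intros z _. apply Hp. exact I. }
  assert (Hsurj : forall t, exists s, H s = t).
  { apply (quasiperiodic_surj H (4 * Ku) (H (4 * Ku))); try assumption; [apply time_continuous|lra]. }
  exists x, y. split; [|split; [|split]].
  - intros t _. apply Hsol. destruct (Hsurj t) as [s Hs]. exists s. split; [exact I|exact Hs].
  - apply (initial_state D); try assumption. exact I.
  - exists (H (4 * Ku)). split; [exact HP0|]. intros t. destruct (Hsurj t) as [s <-].
    rewrite <- HP.
    destruct (Hxy s I) as [-> [-> _]]. destruct (Hxy (s + 4 * Ku) I) as [-> [-> _]].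
    rewrite Hu, Hv. split; reflexivity.
  - exists (H Ku). split; [rewrite <- time_0; apply time_incr; lra|].
    destruct (axis_crossings k (2 * k) x y) as [Hn Hneg]; [lia|exact HK| |].
    { intros s _. destruct (Hxy s I) as [? [? _]]. split; assumption. }
    split; [exact Hn|]. split; [exact Hneg|].
    destruct (Hxy Ku I) as [Hx [Hy [Hx1 _]]].
    pose proof (Hp Ku I) as HpK.
    rewrite Hx, Hy, Hx1. rewrite u_Ku in *.
    assert (Hv1 : v1 Ku = 0).
    { unfold v1. rewrite HK, mult_INR. simpl (INR 2). rewrite psi_PI.
      rewrite (sin_eq_0_1 (INR k * PI)); [ring|].
      exists (Z.of_nat k). rewrite INR_IZR_INZ. reflexivity. }
    rewrite Hv1. split; [ring|]. split; [lra|]. unfold Rdiv. ring.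
Qed.

End Orbit.

(** * The ratio of the quarter periods *)

(** For the square roots, [/ x - / y = (y ^ 2 - x ^ 2) / (x * y * (x + y))], and both are at least
    [sqrt c]. *)
Lemma inv_sqrt_lipschitz (c X Y : R) : 0 < c -> c <= X -> c <= Y ->
  Rabs (/ sqrt X - / sqrt Y) <= Rabs (X - Y) / (2 * c * sqrt c).
Proof.
  intros Hc HX HY.
  pose proof (sqrt_lt_R0 c Hc) as Hsc.
  pose proof (sqrt_le_1_alt c X HX) as HsX.
  pose proof (sqrt_le_1_alt c Y HY) as HsY.
  pose proof (sqrt_sqrt X ltac:(lra)) as EX.
  pose proof (sqrt_sqrt Y ltac:(lra)) as EY.
  pose proof (sqrt_sqrt c ltac:(lra)) as Ec.
  set (x := sqrt X) in *. set (y := sqrt Y) in *. set (z := sqrt c) in *.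
  replace (/ x - / y) with (- (X - Y) / (x * y * (x + y))).
  2: { rewrite <- EX, <- EY. field. lra. }
  assert (Hxy : c <= x * y) by (rewrite <- Ec; apply Rmult_le_compat; lra).
  assert (Hden : 2 * c * z <= x * y * (x + y)).
  { replace (2 * c * z) with (c * (2 * z)) by ring. apply Rmult_le_compat; lra. }
  assert (0 < 2 * c * z) by (apply Rmult_lt_0_compat; lra).
  rewrite Rabs_div, Rabs_Ropp, (Rabs_pos_eq (x * y * (x + y))) by lra.
  apply Rmult_le_compat_l; [apply Rabs_pos|].
  apply Rinv_le_contravar; assumption.
Qed.

Lemma osc_lower_bound (A B c t : R) : c <= A -> c <= A - B -> c <= A - B * cos t ^ 2.
Proof.
  intros HA HB. pose proof (cos_sqr_bound t) as Hc.
  replace (A - B * cos t ^ 2) with (A * (1 - cos t ^ 2) + (A - B) * cos t ^ 2) by ring.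
  replace c with (c * (1 - cos t ^ 2) + c * cos t ^ 2) at 1 by ring.
  apply Rplus_le_compat; apply Rmult_le_compat_r; lra.
Qed.

(** Near [d] the radicands stay above a common [c > 0], so the integrands are uniformly close by the
    Lipschitz bound. *)
Lemma quarter_period_continuous (A B : R -> R) (d : R) :
  continuity_pt A d -> continuity_pt B d -> 0 < A d -> 0 < A d - B d ->
  continuity_pt (fun z => quarter_period (A z) (B z)) d.
Proof.
  intros HcA HcB HA HB.
  (* A change of at most [c / 2] in each of [A] and [B] keeps [A] and [A - B] above [c]. *)
  pose (c := Rmin (A d) (A d - B d) / 2).
  assert (Hm1 : 2 * c <= A d) by (unfold c; pose proof (Rmin_l (A d) (A d - B d)); lra).
  assert (Hm2 : 2 * c <= A d - B d)
    by (unfold c; pose proof (Rmin_r (A d) (A d - B d)); lra).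
  assert (Hc : 0 < c).
  { unfold c. assert (0 < Rmin (A d) (A d - B d)) by (apply Rmin_glb_lt; lra). lra. }
  pose (M := / (2 * c * sqrt c)).
  assert (HM : 0 < M).
  { apply Rinv_0_lt_compat. pose proof (sqrt_lt_R0 c Hc). apply Rmult_lt_0_compat; lra. }
  pose proof PI_RGT_0 as HPI.
  assert (HPM : 0 < PI * M) by (apply Rmult_lt_0_compat; assumption).
  intros eps Heps.
  (* The integrands differ by at most [2 * tol * M] over a length [PI / 2]; the second bound makes
     the product at most [eps / 2]. *)
  pose (tol := Rmin (c / 2) (eps / (2 * (PI * M)))).
  assert (Htol1 : tol <= c / 2) by apply Rmin_l.
  assert (Htol2 : tol <= eps / (2 * (PI * M))) by apply Rmin_r.
  assert (Htol : 0 < tol).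
  { apply Rmin_glb_lt; [lra|]. apply Rdiv_lt_0_compat; lra. }
  destruct (continuity_pt_eps A d tol HcA Htol) as [e1 [He1 H1]].
  destruct (continuity_pt_eps B d tol HcB Htol) as [e2 [He2 H2]].
  exists (Rmin e1 e2). split; [apply Rmin_glb_lt; assumption|].
  intros z [_ Hz]. simpl in Hz |- *. unfold R_dist in *.
  pose proof (Rmin_l e1 e2). pose proof (Rmin_r e1 e2).
  specialize (H1 z ltac:(lra)). specialize (H2 z ltac:(lra)).
  pose proof (Rabs_def2 _ _ H1) as H1'. pose proof (Rabs_def2 _ _ H2) as H2'.
  unfold quarter_period, osc_time.
  pose proof (ex_RInt_osc (A z) (B z) 0 (PI / 2) ltac:(lra) ltac:(lra)) as I1.
  pose proof (ex_RInt_osc (A d) (B d) 0 (PI / 2) ltac:(lra) ltac:(lra)) as I2.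
  set (f := fun s => / sqrt (A z - B z * cos s ^ 2)) in *.
  set (g := fun s => / sqrt (A d - B d * cos s ^ 2)) in *.
  replace (RInt f 0 (PI / 2) - RInt g 0 (PI / 2))
    with (RInt (fun s => f s - g s) 0 (PI / 2))
    by exact (RInt_minus (V := R_CompleteNormedModule) f g 0 (PI / 2) I1 I2).
  apply Rle_lt_trans with ((PI / 2 - 0) * (2 * tol * M)).
  - apply abs_RInt_le_const.
    + lra.
    + apply (ex_RInt_minus (V := R_NormedModule) f g); assumption.
    + intros t _.
      pose proof (osc_lower_bound (A z) (B z) c t ltac:(lra) ltac:(lra)) as L1.
      pose proof (osc_lower_bound (A d) (B d) c t ltac:(lra) ltac:(lra)) as L2.
      pose proof (inv_sqrt_lipschitz c _ _ Hc L1 L2) as L.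
      eapply Rle_trans; [exact L|]. apply Rmult_le_compat_r; [apply Rlt_le; exact HM|].
      pose proof (cos_sqr_bound t) as Hct.
      set (q := cos t ^ 2) in *.
      replace (A z - B z * q - (A d - B d * q)) with ((A z - A d) + - ((B z - B d) * q)) by ring.
      eapply Rle_trans; [apply Rabs_triang|]. rewrite Rabs_Ropp, Rabs_mult, (Rabs_pos_eq q) by lra.
      pose proof (Rabs_pos (B z - B d)). nra.
  - apply (Rmult_le_compat_r (2 * (PI * M))) in Htol2; [|lra].
    replace (eps / (2 * (PI * M)) * (2 * (PI * M))) with eps in Htol2 by (field; lra).
    nra.
Qed.

(** Both [A] and [A - B] exceed [1] here, so the integrand is at most [1] over a length
    [PI / 2 <= 2]. *)
Lemma v_period_le (r a : R) : 0 < r < 1 -> -1 < a -> - r < a < r -> v_period r a <= 2.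
Proof.
  intros Hr Ha Hra. unfold v_period, quarter_period, osc_time.
  pose proof (two_div_r r Hr) as Hr2. pose proof PI_4.
  assert (HA : 0 < 2 / r + a + r) by (apply Av_pos; assumption).
  assert (HB : 0 < 2 / r + a + r - (a - r)) by (apply Bv_lt; assumption).
  apply Rle_trans with (RInt (fun _ => 1) 0 (PI / 2)).
  - pose proof PI_RGT_0. apply RInt_le; [lra|apply ex_RInt_osc; assumption|
      apply (ex_RInt_const (V := R_NormedModule))|].
    intros t _. rewrite <- Rinv_1. apply Rinv_le_contravar; [lra|].
    rewrite <- sqrt_1. apply sqrt_le_1_alt. apply osc_lower_bound; lra.
  - rewrite RInt_const. unfold scal; simpl; unfold mult; simpl. lra.
Qed.

(** The radicand is [del + (r + a) * sin t ^ 2 <= e ^ 2 + 2 * t ^ 2 <= (e + 2 * t) ^ 2], and the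
    integral of [/ (e + 2 * t)] is at least [- ln e / 2]. This is the logarithmic blow-up near the
    saddle, as [del] tends to [0] when [r] tends to [1]. *)
Lemma u_period_ge (r a : R) : 0 < r < 1 -> -1 < a -> - r < a < r ->
  - ln (sqrt (2 / r - 2 * r)) / 2 <= u_period r a.
Proof.
  intros Hr Ha Hra. unfold u_period, quarter_period, osc_time.
  pose proof (two_div_r r Hr) as Hr2. pose proof PI_RGT_0 as HPI.
  assert (HA : 0 < 2 / r + a - r) by (apply Au_pos; assumption).
  assert (HB : 0 < 2 / r + a - r - (r + a)) by (apply Bu_lt; assumption).
  set (del := 2 / r - 2 * r). set (e := sqrt del).
  assert (Hdel : 0 < del) by (unfold del; lra).
  assert (He : 0 < e) by (apply sqrt_lt_R0; exact Hdel).
  assert (Ee : e * e = del) by (apply sqrt_sqrt; lra).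
  assert (HI : is_RInt (fun t => / (e + 2 * t)) 0 (PI / 2)
                 (ln (e + 2 * (PI / 2)) / 2 - ln (e + 2 * 0) / 2)).
  { apply (is_RInt_derive (V := R_CompleteNormedModule)
      (fun t => ln (e + 2 * t) / 2) (fun t => / (e + 2 * t)));
      rewrite Rmin_left, Rmax_right by lra; intros t Ht.
    - auto_derive; [lra|]. field. lra.
    - apply (ex_derive_continuous (fun t => / (e + 2 * t))). auto_derive. lra. }
  apply Rle_trans with (RInt (fun t => / (e + 2 * t)) 0 (PI / 2)).
  - rewrite (is_RInt_unique _ _ _ _ HI). rewrite Rmult_0_r, Rplus_0_r.
    assert (0 <= ln (e + 2 * (PI / 2))); [|lra].
    rewrite <- ln_1. apply Rcomplements.ln_le; [lra|].
    pose proof PI2_1. lra.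
  - apply RInt_le; [lra|eexists; exact HI|apply ex_RInt_osc; assumption|].
    intros t Ht.
    pose proof (osc_pos (2 / r + a - r) (r + a) t HA HB) as Hp.
    apply Rinv_le_contravar; [apply sqrt_lt_R0, Hp|].
    apply Rsqr_incr_0_var; [|lra].
    unfold Rsqr. rewrite sqrt_sqrt by lra.
    pose proof (sin2_cos2 t) as Esc. unfold Rsqr in Esc.
    pose proof (sin_lt_x t ltac:(lra)) as Hs.
    pose proof (sin_ge_0 t ltac:(lra) ltac:(lra)) as Hs0.
    replace (2 / r + a - r - (r + a) * cos t ^ 2) with (del + (r + a) * (sin t * sin t)).
    + assert ((r + a) * (sin t * sin t) <= 2 * (t * t)); [|nra].
      apply Rmult_le_compat; nra.
    + replace (sin t * sin t) with (1 - cos t * cos t) by lra. unfold del. ring.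
Qed.

(** * The ratio as a function of the starting height *)

Lemma rad_continuous (a d : R) : continuity_pt (rad a) d.
Proof.
  apply (continuity_pt_comp (fun d => a ^ 2 + d ^ 2) sqrt).
  - eapply (is_derive_continuity_pt (fun d => a ^ 2 + d ^ 2)). auto_derive; [exact I|reflexivity].
  - apply continuity_pt_sqrt. nra.
Qed.

Lemma rad_bounds (a d : R) : 0 < d < sqrt (1 - a ^ 2) -> -1 < a < 1 ->
  0 < rad a d < 1 /\ - rad a d < a < rad a d.
Proof.
  intros Hd Ha.
  assert (Hd2 : d ^ 2 < 1 - a ^ 2).
  { rewrite <- (pow2_sqrt (1 - a ^ 2)) by nra. nra. }
  assert (Hr : rad a d ^ 2 = a ^ 2 + d ^ 2) by (apply pow2_sqrt; nra).
  assert (Hr0 : 0 < rad a d) by (apply sqrt_lt_R0; nra).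
  repeat split; nra.
Qed.

Lemma period_ratio_continuous (a d : R) :
  -1 < a < 1 -> 0 < d < sqrt (1 - a ^ 2) ->
  continuity_pt (fun d => u_period (rad a d) a / v_period (rad a d) a) d.
Proof.
  intros Ha Hd. destruct (rad_bounds a d Hd Ha) as [Hr Hra].
  assert (Hc : forall f : R -> R, continuity_pt f (rad a d) ->
            continuity_pt (fun d => f (rad a d)) d).
  { intros f Hf. apply (continuity_pt_comp (rad a) f); [apply rad_continuous|exact Hf]. }
  assert (Hc' : forall f : R -> R, ex_derive f (rad a d) ->
            continuity_pt (fun d => f (rad a d)) d).
  { intros f Hf. apply Hc, continuity_pt_filterlim, (ex_derive_continuous f), Hf. }
  apply continuity_pt_div.
  - apply (quarter_period_continuous
      (fun d => 2 / rad a d + a - rad a d) (fun d => rad a d + a)).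
    + apply (Hc' (fun r => 2 / r + a - r)). auto_derive. lra.
    + apply (Hc' (fun r => r + a)). auto_derive. exact I.
    + apply Au_pos; lra.
    + apply Bu_lt; lra.
  - apply (quarter_period_continuous
      (fun d => 2 / rad a d + a + rad a d) (fun d => a - rad a d)).
    + apply (Hc' (fun r => 2 / r + a + r)). auto_derive. lra.
    + apply (Hc' (fun r => a - r)). auto_derive. exact I.
    + apply Av_pos; lra.
    + apply Bv_lt; lra.
  - apply Rgt_not_eq, Kv_pos; lra.
Qed.

(** At [b] the distance is [1] and [gap] vanishes, so the lower bound on [u_period] diverges while
    [v_period] stays at most [2]. *)
Lemma period_ratio_diverges (a : R) (N : nat) : -1 < a < 1 ->
  exists d0, sqrt (1 - a ^ 2) / 2 <= d0 < sqrt (1 - a ^ 2) /\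
    forall d, d0 <= d < sqrt (1 - a ^ 2) ->
      INR N < u_period (rad a d) a / v_period (rad a d) a.
Proof.
  intros Ha. set (b := sqrt (1 - a ^ 2)).
  assert (Hb : 0 < b) by (apply sqrt_lt_R0; nra).
  assert (Hrb : rad a b = 1).
  { unfold rad, b. rewrite pow2_sqrt by nra.
    replace (a ^ 2 + (1 - a ^ 2)) with 1 by ring. apply sqrt_1. }
  pose (gap := fun d => sqrt (2 / rad a d - 2 * rad a d)).
  assert (Hgb : gap b = 0).
  { unfold gap. rewrite Hrb. replace (2 / 1 - 2 * 1) with 0 by field. apply sqrt_0. }
  assert (Hgc : continuity_pt gap b).
  { apply (continuity_pt_comp (rad a) (fun r => sqrt (2 / r - 2 * r)));
      [apply rad_continuous|]. rewrite Hrb.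
    apply (continuity_pt_comp (fun r => 2 / r - 2 * r) sqrt).
    - apply continuity_pt_filterlim, (ex_derive_continuous (fun r => 2 / r - 2 * r)).
      auto_derive. lra.
    - apply continuity_pt_sqrt. lra. }
  (* [gap < exp (- (4 * N))] gives [u_period > 2 * N], and dividing by at most [2] leaves a ratio
     above [N]. *)
  destruct (continuity_pt_eps gap b (exp (- (4 * INR N))) Hgc (exp_pos _)) as [eta [Heta Hn]].
  exists (Rmax (b / 2) (b - eta / 2)).
  split; [split; [apply Rmax_l|apply Rmax_lub_lt; lra]|].
  intros d Hd. pose proof (Rmax_l (b / 2) (b - eta / 2)). pose proof (Rmax_r (b / 2) (b - eta / 2)).
  destruct (rad_bounds a d) as [Hr Hra]; [fold b; lra|exact Ha|].
  specialize (Hn d). assert (Hdb : Rabs (d - b) < eta) by (apply Rabs_def1; lra).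
  specialize (Hn Hdb). rewrite Hgb, Rminus_0_r in Hn. apply Rabs_def2 in Hn.
  pose proof (u_period_ge (rad a d) a Hr ltac:(lra) Hra) as Hu.
  pose proof (v_period_le (rad a d) a Hr ltac:(lra) Hra) as Hv.
  assert (Hv0 : 0 < v_period (rad a d) a) by (apply Kv_pos; lra).
  fold (gap d) in Hu.
  assert (Hg : 0 < gap d).
  { apply sqrt_lt_R0. pose proof (two_div_r (rad a d) Hr). lra. }
  assert (Hln : ln (gap d) < - (4 * INR N)).
  { rewrite <- (ln_exp (- (4 * INR N))). apply ln_increasing; lra. }
  apply (Rmult_lt_reg_r (v_period (rad a d) a)); [exact Hv0|].
  replace (u_period (rad a d) a / v_period (rad a d) a * v_period (rad a d) a)
    with (u_period (rad a d) a) by (field; lra).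
  pose proof (pos_INR N). nra.
Qed.

Lemma orbits_exist (a : R) : -1 < a < 1 -> exists kb : nat, stark_conclusion a kb.
Proof.
  intros Ha. set (b := sqrt (1 - a ^ 2)).
  assert (Hb : 0 < b) by (apply sqrt_lt_R0; nra).
  (* The interval starts at [b / 2] so that [d] stays positive, as the orbit constructions
     require. *)
  destruct (levels_of_divergent
    (fun d => u_period (rad a d) a / v_period (rad a d) a) (b / 2) b) as [m0 [c [Hc Hlim]]].
  - lra.
  - intros d Hd. apply period_ratio_continuous; [exact Ha|fold b; lra].
  - intros N. apply period_ratio_diverges, Ha.
  - assert (Hsol : forall m, (m0 <= m)%nat ->
      0 < rad a (c m) < 1 /\ - rad a (c m) < a < rad a (c m) /\ 0 < c m /\
      u_period (rad a (c m)) a = INR m * v_period (rad a (c m)) a).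
    { intros m Hm. destruct (Hc m Hm) as [Hcm [Hf _]].
      destruct (rad_bounds a (c m)) as [Hr Hra]; [fold b; lra|exact Ha|].
      split; [exact Hr|]. split; [exact Hra|]. split; [lra|].
      rewrite <- Hf. field. apply Rgt_not_eq, Kv_pos; lra. }
    (* Even levels give brake orbits and odd levels collision orbits; the interleaving is then the
       monotonicity of [c]. *)
    exists m0, (fun k => c (2 * k)%nat), (fun k => c (2 * k + 1)%nat).
    split; [|split; [|split; [|split]]].
    + intros k Hk. destruct (Hsol (2 * k)%nat ltac:(lia)) as [Hr [Hra [Hc0 HK]]].
      set (r := rad a (c (2 * k)%nat)) in *.
      destruct (osc_phase (2 / r + a - r) (r + a)) as [phi [P1 [P2 P3]]];
        [apply Au_pos; lra|apply Bu_lt; lra|].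
      destruct (osc_phase (2 / r + a + r) (a - r)) as [psi [Q1 [Q2 Q3]]];
        [apply Av_pos; lra|apply Bv_lt; lra|].
      apply (brake_of_phases r a phi psi); try assumption; lra || reflexivity.
    + intros k Hk. destruct (Hsol (2 * k + 1)%nat ltac:(lia)) as [Hr [Hra [Hc0 HK]]].
      set (r := rad a (c (2 * k + 1)%nat)) in *.
      destruct (osc_phase (2 / r + a - r) (r + a)) as [phi [P1 [P2 P3]]];
        [apply Au_pos; lra|apply Bu_lt; lra|].
      destruct (osc_phase (2 / r + a + r) (a - r)) as [psi [Q1 [Q2 Q3]]];
        [apply Av_pos; lra|apply Bv_lt; lra|].
      apply (collision_of_phases r a phi psi); try assumption; lra || reflexivity.
    + apply (is_lim_seq_subseq c b (fun k => (2 * k)%nat)); [|exact Hlim].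
      apply eventually_subseq. intros n. lia.
    + apply (is_lim_seq_subseq c b (fun k => (2 * k + 1)%nat)); [|exact Hlim].
      apply eventually_subseq. intros n. lia.
    + intros k Hk. split.
      * replace (2 * k + 1)%nat with (S (2 * k)) by lia. apply Hc. lia.
      * replace (2 * S k)%nat with (S (2 * k + 1)) by lia. apply Hc. lia.
Qed.

(** * Orbits starting near the equilibrium *)

Lemma weighted_product_le (k K a b : R) : - K <= k <= K -> k * (a * b) <= K * ((a ^ 2 + b ^ 2) / 2).
Proof.
  intros Hk. pose proof (pow2_ge_0 (a - b)). pose proof (pow2_ge_0 (a + b)).
  assert (Hab : - ((a ^ 2 + b ^ 2) / 2) <= a * b <= (a ^ 2 + b ^ 2) / 2) by nra.
  nra.
Qed.

Lemma rad_sqr (x y : R) : rad x y ^ 2 = x ^ 2 + y ^ 2.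
Proof. apply pow2_sqrt. nra. Qed.

Lemma le_rad (x y : R) : x <= rad x y.
Proof.
  pose proof (rad_sqr x y). assert (0 <= rad x y) by apply sqrt_pos.
  nra.
Qed.

(** Reverse triangle inequality around [(1, 0)]: expanding the squares reduces it to
    [x <= rad x y]. *)
Lemma rad_near_one (x y : R) : (x - 1) ^ 2 + y ^ 2 <= 1 / 4 ->
  (rad x y - 1) ^ 2 <= (x - 1) ^ 2 + y ^ 2 /\ 1 / 2 <= rad x y <= 3 / 2.
Proof.
  intros Hn. pose proof (rad_sqr x y) as E. pose proof (le_rad x y) as Hx.
  assert (H1 : (rad x y - 1) ^ 2 <= (x - 1) ^ 2 + y ^ 2) by nra.
  split; [exact H1|]. nra.
Qed.

Lemma inv_cube_bounds (r : R) : 1 / 2 <= r <= 3 / 2 -> 8 / 27 <= / r ^ 3 <= 8.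
Proof.
  intros Hr.
  assert (H1 : 1 / 8 <= r ^ 3 <= 27 / 8).
  { replace (1 / 8) with ((1 / 2) ^ 3) by field. replace (27 / 8) with ((3 / 2) ^ 3) by field.
    split; apply pow_incr; lra. }
  replace (8 / 27) with (/ (27 / 8)) by field. replace 8 with (/ (1 / 8)) at 2 by field.
  split; apply Rinv_le_contravar; lra.
Qed.

(** The left side is the derivative of [deviation] defined below. With [w = / r ^ 3] and
    [1 - w = k * (r - 1)], it becomes a sum of bounded multiples of products of two small
    quantities; [100] is a crude constant. *)
Lemma stark_field_bound (x y p q : R) : (x - 1) ^ 2 + y ^ 2 <= 1 / 4 ->
  2 * (x - 1) * p + 2 * y * q + 2 * p * (- x / rad x y ^ 3 + 1) + 2 * q * (- y / rad x y ^ 3)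
  <= 100 * ((x - 1) ^ 2 + y ^ 2 + p ^ 2 + q ^ 2).
Proof.
  intros Hn. destruct (rad_near_one x y Hn) as [Hm Hr]. set (r := rad x y) in *.
  pose proof (inv_cube_bounds r Hr) as Hw.
  set (w := / r ^ 3) in *.
  assert (Ew : r ^ 3 * w = 1) by (apply Rinv_r, pow_nonzero; lra).
  (* The factor comes from [r ^ 3 - 1 = (r - 1) * (r ^ 2 + r + 1)], and [38] is [19 / 4] times
     [8]. *)
  assert (Hk : 0 <= (r ^ 2 + r + 1) * w <= 38).
  { assert (0 <= r ^ 2 + r + 1 <= 19 / 4) by nra. nra. }
  set (k := (r ^ 2 + r + 1) * w) in *.
  assert (Ekm : 1 - w = k * (r - 1)).
  { unfold k. rewrite <- Ew at 1. ring. }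
  replace (- x / r ^ 3 + 1) with (- (x - 1) * w + k * (r - 1))
    by (rewrite <- Ekm; unfold w, Rdiv; ring).
  replace (- y / r ^ 3) with (- y * w) by (unfold w, Rdiv; ring).
  pose proof (weighted_product_le (1 - w) 8 (x - 1) p ltac:(lra)).
  pose proof (weighted_product_le (1 - w) 8 y q ltac:(lra)).
  pose proof (weighted_product_le k 38 (r - 1) p ltac:(lra)).
  pose proof (pow2_ge_0 p). pose proof (pow2_ge_0 q). pose proof (pow2_ge_0 (x - 1)).
  pose proof (pow2_ge_0 y).
  lra.
Qed.

Section Solution.
Variables (x y : R -> R).
Hypothesis Hsol : stark_sol_on (fun _ => True) x y.

Lemma sol_rad_pos t : 0 < rad (x t) (y t).
Proof. apply (Hsol t I). Qed.
Lemma sol_dx t : is_derive x t (Derive x t).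
Proof. apply Derive_correct, (Hsol t I). Qed.
Lemma sol_dy t : is_derive y t (Derive y t).
Proof. apply Derive_correct, (Hsol t I). Qed.
Lemma sol_ddx t : is_derive (Derive x) t (- x t / rad (x t) (y t) ^ 3 + 1).
Proof. apply (Hsol t I). Qed.
Lemma sol_ddy t : is_derive (Derive y) t (- y t / rad (x t) (y t) ^ 3).
Proof. apply (Hsol t I). Qed.

Lemma sol_drad t : is_derive (fun t => rad (x t) (y t)) t
  ((x t * Derive x t + y t * Derive y t) / rad (x t) (y t)).
Proof.
  pose proof (sol_rad_pos t) as Hr. unfold rad in *.
  assert (Hp : 0 < x t ^ 2 + y t ^ 2).
  { destruct (Rle_lt_dec (x t ^ 2 + y t ^ 2) 0) as [H|H]; [|exact H].
    rewrite sqrt_neg_0 in Hr by exact H. lra. }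
  assert (ex : ex_derive x t) by (eexists; apply sol_dx).
  assert (ey : ex_derive y t) by (eexists; apply sol_dy).
  auto_derive; [auto|].
  change (Derive (fun z => x z) t) with (Derive x t).
  change (Derive (fun z => y z) t) with (Derive y t).
  simpl in Hr |- *. field. lra.
Qed.

(** Squared distance in phase space to the equilibrium at rest in [(1, 0)]. *)
Definition deviation t := (x t - 1) ^ 2 + y t ^ 2 + Derive x t ^ 2 + Derive y t ^ 2.

Lemma is_derive_deviation t : is_derive deviation t
  (2 * (x t - 1) * Derive x t + 2 * y t * Derive y t +
   2 * Derive x t * (- x t / rad (x t) (y t) ^ 3 + 1) +
   2 * Derive y t * (- y t / rad (x t) (y t) ^ 3)).
Proof.
  pose proof (sol_dx t) as H1. pose proof (sol_dy t) as H2.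
  pose proof (sol_ddx t) as H3. pose proof (sol_ddy t) as H4.
  pose (p := Derive x). pose (q := Derive y).
  change (is_derive (fun t => (x t - 1) ^ 2 + y t ^ 2 + p t ^ 2 + q t ^ 2) t
    (2 * (x t - 1) * p t + 2 * y t * q t +
     2 * p t * (- x t / rad (x t) (y t) ^ 3 + 1) +
     2 * q t * (- y t / rad (x t) (y t) ^ 3))).
  change (is_derive x t (p t)) in H1. change (is_derive y t (q t)) in H2.
  change (is_derive p t (- x t / rad (x t) (y t) ^ 3 + 1)) in H3.
  change (is_derive q t (- y t / rad (x t) (y t) ^ 3)) in H4.
  assert (ex_derive x t) by (eexists; exact H1).
  assert (ex_derive y t) by (eexists; exact H2).
  assert (ex_derive p t) by (eexists; exact H3).
  assert (ex_derive q t) by (eexists; exact H4).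
  clearbody p q.
  auto_derive; [auto|].
  replace (Derive (fun z => x z) t) with (p t) by (symmetry; apply is_derive_unique, H1).
  replace (Derive (fun z => y z) t) with (q t) by (symmetry; apply is_derive_unique, H2).
  replace (Derive (fun z => p z) t) with (- x t / rad (x t) (y t) ^ 3 + 1)
    by (symmetry; apply is_derive_unique, H3).
  replace (Derive (fun z => q z) t) with (- y t / rad (x t) (y t) ^ 3)
    by (symmetry; apply is_derive_unique, H4).
  simpl. ring.
Qed.

(** While [deviation < 1 / 4], the field bound makes [deviation t * exp (- 100 * t)]
    nonincreasing. *)
Lemma deviation_gronwall tau :
  0 < tau -> (forall t, 0 <= t < tau -> deviation t < 1 / 4) ->
  deviation tau <= deviation 0 * exp (100 * tau).
Proof.
  intros Htau Hsmall.
  set (F' := fun t => 2 * (x t - 1) * Derive x t + 2 * y t * Derive y t +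
   2 * Derive x t * (- x t / rad (x t) (y t) ^ 3 + 1) +
   2 * Derive y t * (- y t / rad (x t) (y t) ^ 3)).
  destruct (MVT_cor2 (fun t => deviation t * exp (- 100 * t))
    (fun t => (F' t - 100 * deviation t) * exp (- 100 * t)) 0 tau Htau) as [c [Heq Hc]].
  { intros t _. apply is_derive_Reals. eapply is_derive_eq.
    - apply (is_derive_mult deviation (fun t => exp (- 100 * t))).
      + apply is_derive_deviation.
      + auto_derive; [exact I|reflexivity].
      + intros; apply Rmult_comm.
    - unfold plus, mult; simpl. unfold F'; simpl. ring. }
  assert (HF : F' c <= 100 * deviation c).
  { apply stark_field_bound. specialize (Hsmall c ltac:(lra)). unfold deviation in Hsmall.
    pose proof (pow2_ge_0 (Derive x c)). pose proof (pow2_ge_0 (Derive y c)). lra. }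
  pose proof (exp_pos (- 100 * c)) as Hexp.
  assert (Hle : deviation tau * exp (- 100 * tau) <= deviation 0).
  { rewrite Rmult_0_r, exp_0 in Heq.
    assert (0 <= (100 * deviation c - F' c) * exp (- 100 * c) * (tau - 0));
      [apply Rmult_le_pos; [apply Rmult_le_pos|]; lra|lra]. }
  apply (Rmult_le_compat_r (exp (100 * tau))) in Hle; [|apply Rlt_le, exp_pos].
  rewrite Rmult_assoc, <- exp_plus in Hle.
  replace (- 100 * tau + 100 * tau) with 0 in Hle by ring.
  rewrite exp_0, Rmult_1_r in Hle. exact Hle.
Qed.

(** Continuity argument: at the first time [deviation] would reach [1 / 4], the exponential bound
    still holds and keeps it below. *)
Lemma deviation_small L : 0 <= deviation 0 ->
  deviation 0 * exp (100 * L) < 1 / 4 -> forall t, 0 <= t <= L -> deviation t < 1 / 4.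
Proof.
  intros H0 HL t Ht.
  assert (Hmono : forall s, s <= L -> deviation 0 * exp (100 * s) < 1 / 4).
  { intros s Hs. eapply Rle_lt_trans; [|exact HL]. apply Rmult_le_compat_l; [exact H0|].
    destruct (Req_dec s L) as [->|]; [lra|]. apply Rlt_le, exp_increasing. lra. }
  assert (Hd0 : deviation 0 < 1 / 4).
  { specialize (Hmono 0 ltac:(lra)). rewrite Rmult_0_r, exp_0 in Hmono. lra. }
  destruct (Rlt_le_dec (deviation t) (1 / 4)) as [|Hge]; [assumption|exfalso].
  destruct (first_crossing deviation 0 t (1 / 4)) as [tau [Htau [Heq Hlt]]].
  - lra.
  - intros z _. eapply is_derive_continuity_pt, is_derive_deviation.
  - lra.
  - pose proof (deviation_gronwall tau ltac:(lra) Hlt) as Hg.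
    specialize (Hmono tau ltac:(lra)). lra.
Qed.

(* Sturm comparison with [sin ((t - s) / 2)]: there [y'' = - y / r ^ 3] with
   [/ r ^ 3 > 1 / 4]. *)
Lemma y_zero_in_interval s :
  (forall t, s <= t <= s + 2 * PI -> deviation t < 1 / 4) ->
  exists t, s < t < s + 2 * PI /\ y t = 0.
Proof.
  intros Hdev. pose proof PI_RGT_0 as HPI.
  apply NNPP. intros Hno.
  assert (Hnz : forall t, s < t < s + 2 * PI -> y t <> 0).
  { intros t Ht E. apply Hno. exists t. split; assumption. }
  assert (Hcy : forall t, continuity_pt y t)
    by (intros t; eapply is_derive_continuity_pt, sol_dy).
  (* Without zeros [y] keeps the sign of its midpoint value, so that value serves as [sg]. *)
  assert (Hsign : exists sg, forall t, s < t < s + 2 * PI -> 0 < sg * y t).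
  { exists (y (s + PI)). intros t Ht.
    pose proof (Hnz (s + PI) ltac:(lra)) as Hn1. pose proof (Hnz t Ht) as Hn2.
    destruct (Rlt_le_dec 0 (y (s + PI) * y t)) as [|Hle]; [assumption|exfalso].
    assert (Hlt : y (s + PI) * y t < 0).
    { destruct Hle as [|E]; [assumption|]. apply Rmult_integral in E. tauto. }
    pose (f := fun z => y z * y (s + PI)).
    assert (Hf : forall z, continuity_pt f z).
    { intros z. apply continuity_pt_mult; [apply Hcy|].
      apply continuity_pt_const. intros ? ?. reflexivity. }
    assert (0 < f (s + PI)) by (unfold f; nra).
    assert (f t < 0) by (unfold f; lra).
    assert (Hz : forall z, s < z < s + 2 * PI -> f z <> 0).
    { intros z Hz E. apply Rmult_integral in E. specialize (Hnz z Hz). tauto. }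
    destruct (Rle_lt_dec t (s + PI)) as [Hle'|Hle'].
    - destruct (first_crossing f t (s + PI) 0) as [z [Hz1 [Hz2 _]]]; [lra|auto|lra|].
      apply (Hz z); [lra|exact Hz2].
    - destruct (last_crossing (fun z => - f z) (s + PI) t 0) as [z [Hz1 [Hz2 _]]];
        [lra|intros; apply continuity_pt_opp; auto|lra|].
      apply (Hz z); lra. }
  destruct Hsign as [sg Hsg].
  assert (Hend : 0 <= sg * y s /\ 0 <= sg * y (s + 2 * PI)).
  { assert (Hlimit : forall b, (s = b \/ s + 2 * PI = b) -> 0 <= sg * y b).
    { intros b Hb. destruct (Rle_lt_dec 0 (sg * y b)) as [|Hneg]; [assumption|exfalso].
      destruct (continuity_pt_eps (fun z => sg * y z) b (- (sg * y b))) as [eta [Heta Hn]].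
      - apply continuity_pt_mult; [|apply Hcy]. apply continuity_pt_const. intros ? ?; reflexivity.
      - lra.
      - pose (m := Rmin eta PI / 2).
        assert (0 < Rmin eta PI) by (apply Rmin_glb_lt; lra).
        pose proof (Rmin_l eta PI). pose proof (Rmin_r eta PI).
        destruct Hb as [Hb|Hb].
        + specialize (Hn (b + m)). specialize (Hsg (b + m) ltac:(unfold m; lra)).
          rewrite Rabs_pos_eq in Hn by (unfold m; lra). specialize (Hn ltac:(unfold m; lra)).
          apply Rabs_def2 in Hn. lra.
        + specialize (Hn (b - m)). specialize (Hsg (b - m) ltac:(unfold m; lra)).
          rewrite Rabs_left1 in Hn by (unfold m; lra). specialize (Hn ltac:(unfold m; lra)).
          apply Rabs_def2 in Hn. lra. }
    split; apply Hlimit; auto. }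
  (* Wronskian of [y] and the comparison sine. Its increment is [(y s + y (s + 2 * PI)) / 2],
     nonnegative after multiplication by [sg], while [sg] times its derivative is negative because
     [/ r ^ 3 >= 8 / 27 > 1 / 4]. *)
  pose (W := fun t => Derive y t * sin ((t - s) / 2) - y t * (cos ((t - s) / 2) / 2)).
  destruct (MVT_cor2 W
    (fun t => (- y t / rad (x t) (y t) ^ 3) * sin ((t - s) / 2) + y t * sin ((t - s) / 2) / 4)
    s (s + 2 * PI) ltac:(lra)) as [c [Heq Hc]].
  { intros t _. apply is_derive_Reals. eapply is_derive_eq.
    - apply (is_derive_minus (fun t => Derive y t * sin ((t - s) / 2))
        (fun t => y t * (cos ((t - s) / 2) / 2))).
      + apply (is_derive_mult (Derive y) (fun t => sin ((t - s) / 2))).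
        * apply sol_ddy.
        * auto_derive; [exact I|reflexivity].
        * intros; apply Rmult_comm.
      + apply (is_derive_mult y (fun t => cos ((t - s) / 2) / 2)).
        * apply sol_dy.
        * auto_derive; [exact I|reflexivity].
        * intros; apply Rmult_comm.
    - unfold minus, plus, mult, opp; simpl. unfold Rdiv, Rminus. field.
      apply Rgt_not_eq. apply sol_rad_pos. }
  unfold W in Heq.
  replace ((s + 2 * PI - s) / 2) with PI in Heq by field.
  replace ((s - s) / 2) with 0 in Heq by field.
  rewrite sin_PI, cos_PI, sin_0, cos_0 in Heq.
  assert (Hsin : 0 < sin ((c - s) / 2)) by (apply sin_gt_0; lra).
  specialize (Hdev c ltac:(lra)). unfold deviation in Hdev.
  pose proof (pow2_ge_0 (Derive x c)). pose proof (pow2_ge_0 (Derive y c)).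
  destruct (rad_near_one (x c) (y c)) as [_ Hr]; [lra|].
  pose proof (inv_cube_bounds _ Hr) as Hw.
  specialize (Hsg c Hc).
  assert (Hpos : 0 < sg * y c * (/ rad (x c) (y c) ^ 3 - 1 / 4) * sin ((c - s) / 2) * (2 * PI)).
  { apply Rmult_lt_0_compat; [apply Rmult_lt_0_compat; [apply Rmult_lt_0_compat|]|]; lra. }
  apply (f_equal (Rmult sg)) in Heq. unfold Rdiv in *. nra.
Qed.

(** One zero is taken from each of [n] consecutive open intervals of length [2 * PI]; disjointness
    makes them distinct. *)
Lemma y_zeros n : (forall t, 0 <= t <= INR n * (2 * PI) -> deviation t < 1 / 4) ->
  exists l : list R, NoDup l /\ length l = n /\
    forall t, In t l -> 0 < t < INR n * (2 * PI) /\ y t = 0.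
Proof.
  pose proof PI_RGT_0 as HPI.
  induction n as [|n IH]; intros Hdev.
  - exists nil. split; [constructor|]. split; [reflexivity|]. intros t [].
  - rewrite S_INR in *. pose proof (pos_INR n) as Hn.
    assert (0 <= INR n * (2 * PI)) by (apply Rmult_le_pos; lra).
    destruct IH as [l [Hnd [Hlen Hl]]].
    { intros t Ht. apply Hdev. lra. }
    destruct (y_zero_in_interval (INR n * (2 * PI))) as [t [Ht Hy]].
    { intros t Ht. apply Hdev. lra. }
    exists (t :: l). split; [|split].
    + constructor; [|exact Hnd]. intros Hin. apply Hl in Hin. lra.
    + simpl. rewrite Hlen. reflexivity.
    + intros z [<-|Hz]; [split; [lra|exact Hy]|]. destruct (Hl z Hz) as [? ?].
      split; [lra|assumption].
Qed.


(** * First integrals and the forbidden region *)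

Definition neg_energy t := / rad (x t) (y t) + x t - (Derive x t ^ 2 + Derive y t ^ 2) / 2.

(** Minus the Runge-Lenz component along the field, with the correction [y ^ 2 / 2] due to the
    uniform force: the second first integral. *)
Definition lenz t := Derive y t * (y t * Derive x t - x t * Derive y t) +
  x t / rad (x t) (y t) - y t ^ 2 / 2.

Lemma invariants_constant s t : neg_energy s = neg_energy t /\ lenz s = lenz t.
Proof.
  assert (Hd : forall z, is_derive neg_energy z 0 /\ is_derive lenz z 0).
  { intros z.
    pose proof (sol_dx z) as H1. pose proof (sol_dy z) as H2.
    pose proof (sol_ddx z) as H3. pose proof (sol_ddy z) as H4.
    pose proof (sol_drad z) as H5. pose proof (sol_rad_pos z) as Hr.
    pose proof (rad_sqr (x z) (y z)) as Er.
    unfold neg_energy, lenz.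
    set (p := Derive x) in *. set (q := Derive y) in *.
    set (r := fun t => rad (x t) (y t)).
    change (is_derive p z (- x z / r z ^ 3 + 1)) in H3.
    change (is_derive q z (- y z / r z ^ 3)) in H4.
    change (is_derive r z ((x z * p z + y z * q z) / r z)) in H5.
    change (0 < r z) in Hr. change (r z ^ 2 = x z ^ 2 + y z ^ 2) in Er.
    assert (ex_derive x z) by (eexists; exact H1).
    assert (ex_derive y z) by (eexists; exact H2).
    assert (ex_derive p z) by (eexists; exact H3).
    assert (ex_derive q z) by (eexists; exact H4).
    assert (ex_derive r z) by (eexists; exact H5).
    change (is_derive (fun t => / r t + x t - (p t ^ 2 + q t ^ 2) / 2) z 0 /\
      is_derive (fun t => q t * (y t * p t - x t * q t) + x t / r t - y t ^ 2 / 2) z 0).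
    clearbody p q r.
    apply is_derive_unique in H1, H2, H3, H4, H5.
    assert (Ey : y z * y z = r z * r z - x z * x z) by lra.
    split; (auto_derive; [repeat split; auto; lra|]);
      change (Derive (fun t => x t) z) with (Derive x z);
      change (Derive (fun t => y t) z) with (Derive y z);
      change (Derive (fun t => p t) z) with (Derive p z);
      change (Derive (fun t => q t) z) with (Derive q z);
      change (Derive (fun t => r t) z) with (Derive r z);
      rewrite H1, ?H2, ?H3, ?H4, H5.
    - simpl. field. lra.
    - transitivity (p z * (r z * r z - x z * x z - y z * y z) / r z ^ 3); [field; lra|].
      rewrite Ey. field. lra. }
  split; [apply (eq_of_derive_0 neg_energy)|apply (eq_of_derive_0 lenz)]; apply Hd.
Qed.

(** [P = r + x] is [u ^ 2] in parabolic coordinates. [lenz + 1] is half a quadratic form in the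
    velocity plus [neg_energy * P - P ^ 2 / 2]. The form has zero discriminant, so it is nonnegative
    for [P > 0], and it vanishes at time [0]; comparing the two times gives the factored
    inequality. *)
Lemma parabolic_range t : Derive x 0 = 0 -> Derive y 0 = 0 ->
  let P0 := rad (x 0) (y 0) + x 0 in
  let P := rad (x t) (y t) + x t in
  0 < P -> 0 <= (P - P0) * (P + P0 - 2 * neg_energy 0).
Proof.
  intros Hp0 Hq0 P0 P HP.
  destruct (invariants_constant 0 t) as [He Hl].
  assert (Hquad : forall s, lenz s + 1 =
    ((rad (x s) (y s) + x s) * Derive x s ^ 2 + 2 * y s * Derive x s * Derive y s +
     (rad (x s) (y s) - x s) * Derive y s ^ 2) / 2 +
    neg_energy s * (rad (x s) (y s) + x s) - (rad (x s) (y s) + x s) ^ 2 / 2).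
  { intros s. unfold lenz, neg_energy. pose proof (sol_rad_pos s) as Hr.
    pose proof (rad_sqr (x s) (y s)) as Er.
    replace (y s ^ 2) with (rad (x s) (y s) ^ 2 - x s ^ 2) by lra. field. lra. }
  pose proof (Hquad 0) as E0. pose proof (Hquad t) as Et.
  rewrite Hp0, Hq0 in E0. rewrite <- Hl, <- He in Et.
  fold P in Et. fold P0 in E0.
  assert (Hnn : 0 <= P * Derive x t ^ 2 + 2 * y t * Derive x t * Derive y t +
                  (rad (x t) (y t) - x t) * Derive y t ^ 2).
  { apply (Rmult_le_reg_l P); [exact HP|]. rewrite Rmult_0_r.
    pose proof (rad_sqr (x t) (y t)) as Er.
    replace (P * (P * Derive x t ^ 2 + 2 * y t * Derive x t * Derive y t +
                  (rad (x t) (y t) - x t) * Derive y t ^ 2))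
      with ((P * Derive x t + y t * Derive y t) ^ 2 +
            (rad (x t) (y t) ^ 2 - x t ^ 2 - y t ^ 2) * Derive y t ^ 2)
      by (unfold P; ring).
    rewrite Er. pose proof (pow2_ge_0 (P * Derive x t + y t * Derive y t)). lra. }
  nra.
Qed.

(* Starting at rest outside the unit circle, [r + x] cannot enter the forbidden
   gap below its initial value. *)
Lemma no_negative_axis T : Derive x 0 = 0 -> Derive y 0 = 0 ->
  1 < rad (x 0) (y 0) -> 0 <= T -> y T = 0 -> x T < 0 -> 0 < rad (x 0) (y 0) + x 0 -> False.
Proof.
  intros Hp Hq Hr HT Hy Hx HP0.
  set (r0 := rad (x 0) (y 0)) in *. set (P0 := r0 + x 0) in *.
  set (P := fun t => rad (x t) (y t) + x t).
  assert (HPT : P T = 0).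
  { unfold P. rewrite Hy. unfold rad. replace (x T ^ 2 + 0 ^ 2) with ((- x T) ^ 2) by ring.
    rewrite sqrt_pow2; lra. }
  assert (HE : neg_energy 0 < P0).
  { unfold neg_energy, P0. fold r0. rewrite Hp, Hq.
    assert (/ r0 < 1) by (rewrite <- Rinv_1; apply Rinv_lt_contravar; lra). lra. }
  set (E := neg_energy 0) in *.
  (* Strictly between [Rmax 0 (2 * E - P0)] and [P0] the product in [parabolic_range] is negative,
     yet [P] must take the value [c] on its way from [P0] to [0]. *)
  pose (c := (Rmax 0 (2 * E - P0) + P0) / 2).
  pose proof (Rmax_l 0 (2 * E - P0)) as Hm1. pose proof (Rmax_r 0 (2 * E - P0)) as Hm2.
  assert (Hm3 : Rmax 0 (2 * E - P0) < P0) by (apply Rmax_lub_lt; lra).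
  assert (HcP : 0 < c < P0) by (unfold c; lra).
  destruct (first_crossing (fun t => - P t) 0 T (- c)) as [t [_ [Hpt _]]].
  - exact HT.
  - intros t _. apply continuity_pt_opp, continuity_pt_plus.
    + eapply is_derive_continuity_pt, sol_drad.
    + eapply is_derive_continuity_pt, sol_dx.
  - rewrite HPT. assert (P 0 = P0) by reflexivity. lra.
  - assert (HPt : P t = c) by lra.
    pose proof (parabolic_range t Hp Hq) as Hrange. cbv zeta in Hrange.
    fold (P t) in Hrange. rewrite HPt in Hrange. fold r0 P0 E in Hrange.
    specialize (Hrange ltac:(lra)). unfold c in *. nra.
Qed.

End Solution.

(** An orbit starting close to [(1, 0)] stays in a region with [x > 0] for a time [M * (2 * PI)];
    the zeros of [y] met meanwhile are crossings of the positive axis before [T], so [k] is at least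
    [M]. *)
Lemma brake_index_large (M : nat) : exists delta : R, 0 < delta /\
  forall a d k, 1 - delta < a < 1 -> d <= sqrt (1 - a ^ 2) -> brake_orbit_k a d k ->
    (M <= k)%nat.
Proof.
  pose proof PI_RGT_0 as HPI. pose proof (pos_INR M) as HM.
  pose (L := INR M * (2 * PI)).
  assert (HL : 0 <= L) by (apply Rmult_le_pos; lra).
  assert (Hexp : 1 <= exp (100 * L)).
  { destruct (Req_dec L 0) as [->|]; [rewrite Rmult_0_r, exp_0; lra|].
    rewrite <- exp_0. apply Rlt_le, exp_increasing. lra. }
  (* In the closed unit disc the initial deviation is at most [2 * (1 - a)], less than twice this
     constant; growth by [exp (100 * L)] keeps it below [1 / 8]. *)
  exists (/ (16 * exp (100 * L))).
  assert (Hdelta : 0 < / (16 * exp (100 * L)) < 1).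
  { split; [apply Rinv_0_lt_compat; lra|]. rewrite <- Rinv_1.
    apply Rinv_lt_contravar; lra. }
  split; [apply Hdelta|].
  intros a d k Ha Hd [x [y [Hsol [[Hx0 [Hy0 [Hp0 Hq0]]] [_ [T [HT [Hn [_ [HyT [HxT _]]]]]]]]]]].
  assert (Ha2 : 0 < 1 - a ^ 2) by nra.
  assert (Hb2 : sqrt (1 - a ^ 2) ^ 2 = 1 - a ^ 2) by (apply pow2_sqrt; lra).
  assert (Hb : 0 < sqrt (1 - a ^ 2)) by (apply sqrt_lt_R0; exact Ha2).
  (* The hypothesis bounds [d] from above only; a lower [d] starts outside the unit circle, where
     the negative axis cannot be reached. *)
  destruct (Rlt_le_dec d (- sqrt (1 - a ^ 2))) as [Hlow|Hlow].
  { exfalso. apply (no_negative_axis x y Hsol T); try assumption; try lra.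
    - rewrite Hx0, Hy0. unfold rad. rewrite <- sqrt_1 at 1. apply sqrt_lt_1; nra.
    - rewrite Hx0. pose proof (sqrt_pos (a ^ 2 + y 0 ^ 2)). unfold rad. lra. }
  assert (Hd2 : d ^ 2 <= 1 - a ^ 2) by nra.
  assert (Hdev0 : 0 <= deviation x y 0 < 2 * / (16 * exp (100 * L))).
  { unfold deviation. rewrite Hx0, Hy0, Hp0, Hq0. split; nra. }
  assert (Hdev : forall t, 0 <= t <= L -> deviation x y t < 1 / 4).
  { apply (deviation_small x y Hsol L); [lra|].
    apply Rlt_le_trans with (2 * / (16 * exp (100 * L)) * exp (100 * L)).
    - apply Rmult_lt_compat_r; lra.
    - replace (2 * / (16 * exp (100 * L)) * exp (100 * L)) with (1 / 8) by (field; lra). lra. }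
  assert (Hxpos : forall t, 0 <= t <= L -> 0 < x t).
  { intros t Ht. specialize (Hdev t Ht). unfold deviation in Hdev.
    pose proof (pow2_ge_0 (y t)). pose proof (pow2_ge_0 (Derive x t)).
    pose proof (pow2_ge_0 (Derive y t)). nra. }
  assert (HTL : L < T).
  { destruct (Rlt_le_dec L T) as [|Hle]; [assumption|].
    specialize (Hxpos T ltac:(lra)). lra. }
  destruct (y_zeros x y Hsol M Hdev) as [l [Hnd [Hlen Hl]]].
  destruct Hn as [l' [_ [Hlen' Hl']]].
  rewrite <- Hlen, <- Hlen'. apply NoDup_incl_length; [exact Hnd|].
  intros t Ht. apply Hl'. destruct (Hl t Ht) as [Ht1 Hy]. fold L in Ht1.
  split; [lra|]. split; [exact Hy|]. apply Hxpos. lra.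
Qed.

(** From [kb] on, [d k < d' k < d (S k)] makes [d] increasing, so its term at [kb] lies below its
    limit. *)
Lemma stark_conclusion_below (a : R) (kb : nat) :
  stark_conclusion a kb -> exists d, d <= sqrt (1 - a ^ 2) /\ brake_orbit_k a d kb.
Proof.
  intros [d [d' [Hbrake [_ [Hlim [_ Hord]]]]]].
  exists (d kb). split; [|apply Hbrake; lia].
  apply (is_lim_seq_incr_compare (fun n => d (n + kb)%nat) (sqrt (1 - a ^ 2)))
    with (n := 0%nat).
  - apply (is_lim_seq_incr_n d kb). exact Hlim.
  - intros n. simpl. destruct (Hord (n + kb)%nat ltac:(lia)). lra.
Qed.

Theorem theorem1p4 :
  (forall a' : R, -1 < a' < 1 -> exists kb : nat, stark_conclusion a' kb) /\
  (* the least admissible k_b(a') tends to +oo as a' -> 1 *)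
  (forall M : nat, exists delta : R, 0 < delta /\
     forall a' : R, 1 - delta < a' < 1 ->
       forall kb : nat, stark_conclusion a' kb -> (M <= kb)%nat).
Proof.
  split; [exact orbits_exist|].
  intros M. destruct (brake_index_large M) as [delta [Hdelta Hlarge]].
  exists delta. split; [exact Hdelta|].
  (* Any admissible [kb] is itself the index of a brake orbit, so the lower bound on indices applies
     to it. *)
  intros a Ha kb Hkb. destruct (stark_conclusion_below a kb Hkb) as [d [Hd Hbrake]].
  exact (Hlarge a d kb Ha Hd Hbrake).
Qed.
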